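(* Let $G$ be an edge-weighted graph with constant doubling dimension $d$. For any $\varepsilon \in (0,1)$, one can construct a spanning $(1+\varepsilon)$-tree cover for $G$ consisting of $\varepsilon^{-\tilde{O}(d)}$ trees.
   Context: The doubling dimension of a graph $G$ is the doubling dimension of its shortest-path metric $d_G$; a metric has doubling dimension $d$ if every ball of radius $r>0$ can be covered by at most $2^d$ balls of radius $r/2$. A spanning $t$-tree cover of $G$ is a collection $\mathcal{T}$ of trees, each of which is a spanning subgraph of $G$ (using only edges of $G$, with their weights), such that for every pair of vertices $u,v$ there is $T \in \mathcal{T}$ with $d_T(u,v) \le t \cdot d_G(u,v)$. The notation $\tilde{O}(g)$ hides factors polylogarithmic in $g$.
   Formalization: The number of trees is bounded by min(ε,1/2)^{-Õ(d)} instead of ε^{-Õ(d)}, since as ε tends to 1 the literal bound would force a single tree, which fails for cycles; for ε ≤ 1/2 the bound is literal. *)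

(* Defs.v *)
From HB Require Import structures.
From mathcomp Require Import all_boot all_order all_algebra.
From mathcomp Require Import all_classical all_reals all_analysis.

Set Implicit Arguments.
Unset Strict Implicit.
Unset Printing Implicit Defensive.

Import Order.TTheory GRing.Theory Num.Theory.
Local Open Scope classical_set_scope.
Local Open Scope ring_scope.

Record graph (V : finType) := Graph {
  adj : rel V;
  adj_sym : symmetric adj;
  adj_irr : irreflexive adj }.

Definition connected_graph (V : finType) (G : graph V) : Prop :=
  forall u v : V, connect (adj G) u v.

(* The duplicate-free closed walk [:: u; v] that traverses an edge back and
   forth is an ucycle, but not a cycle of the graph. *)
Definition acyclic (V : finType) (G : graph V) : Prop :=
  forall c : seq V, ucycle (adj G) c -> (size c <= 2)%N.

Definition is_tree (V : finType) (G : graph V) : Prop :=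
  connected_graph G /\ acyclic G.

(* Only the values of w on adjacent pairs matter. *)
Definition edge_weight (R : realType) (V : finType) (G : graph V)
    (w : V -> V -> R) : Prop :=
  forall u v : V, adj G u v -> 0 < w u v /\ w u v = w v u.

Definition walk_weight (R : realType) (V : finType) (w : V -> V -> R)
    (u : V) (p : seq V) : R :=
  \sum_(e <- zip (u :: p) p) w e.1 e.2.

(* The infimum is the least weight of a walk from u to v when there is one; it
   takes the junk value 0 when u and v are not connected. *)
Definition graph_dist (R : realType) (V : finType) (G : graph V)
    (w : V -> V -> R) (u v : V) : R :=
  inf [set walk_weight w u p
      | p in [set p : seq V | path (adj G) u p /\ last u p = v]].

(* Balls are closed; for a metric on a finite set, open balls give the same
   notion. *)
Definition doubling_dimension (R : realType) (V : finType) (dist : V -> V -> R)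
    (d : R) : Prop :=
  forall (x : V) (r : R), 0 < r ->
  exists S : {set V}, #|S|%:R <= 2 `^ d /\
    forall y : V, dist x y <= r -> exists2 c, c \in S & dist c y <= r / 2.

Definition spanning_tree_cover (R : realType) (V : finType) (G : graph V)
    (w : V -> V -> R) (t : R) (N : nat) (T : 'I_N -> graph V) : Prop :=
  (forall i, subrel (adj (T i)) (adj G) /\ is_tree (T i)) /\
  (forall u v : V, exists i, graph_dist (T i) w u v <= t * graph_dist G w u v).

(* f = O~(g) on [0, +oo[, with constants uniform over the whole half-line; the
   shift by 2 keeps the logarithm positive. *)
Definition softO (R : realType) (f g : R -> R) : Prop :=
  exists (C : R) (k : nat), forall x : R, 0 <= x ->
    `|f x| <= C * `|g x| * ln (2 + `|g x|) ^+ k.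

(* Main.v *)
(* A tree is built along a laminar family of clusters, one family for each colour
   of the centres and each offset of a geometric sequence of scales. At scale rho,
   the centres are the points of one colour class of a (rho/8)-net, pairwise more
   than 5 rho apart, and the cluster of a centre is a connected set of radius
   O(rho) that swallows every lower cluster it meets. Inside a cluster X, whose
   subset S is already joined together, shortest paths of X are laid as strands,
   each from a starting point up to the first lower cluster that contains a vertex
   already reached. The first strands join a chosen pair of points to S, in such a
   way that the distance of the pair is almost preserved; then strands start from
   finer and finer nets of X, a colour at a time so that they seldom concatenate.
   A lower cluster now meets S and the strands in a subset of S or of a single
   strand, which plays the role of S in the recursion. Only the pointers of each
   strand towards S are recorded, and at the top level, where S is a single vertex,
   the pointers form a spanning tree.

   A pair at distance about rho/16 to rho/32 lies in the cluster of a nearby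
   centre, close to a pair of net points. The doubling property bounds the number
   of colours by 2^(O(d)) and the number of pairs by eps^(-O(d)), and clusters of
   consecutive scales do not interfere as soon as the ratio of these scales is
   eps^(-O(d)) 2^(O(d^2)), whence O(d^2 log(1/eps)) offsets. *)

Require Import Defs.
From HB Require Import structures.
From mathcomp Require Import all_boot all_order all_algebra.
From mathcomp Require Import all_classical all_reals all_analysis.
From mathcomp Require Import lra ring zify fintype finset.

Set Implicit Arguments.
Unset Strict Implicit.
Unset Printing Implicit Defensive.

Import Order.TTheory GRing.Theory Num.Theory.
Local Open Scope ring_scope.

(** * Walks and distances *)

Section Walks.
Variables (R : realType) (V : finType) (w : V -> V -> R).
Implicit Types (H : graph V) (u v x y : V) (p : seq V).

Lemma walk_weight_nil u : walk_weight w u [::] = 0.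
Proof. by rewrite /walk_weight /= big_nil. Qed.

Lemma walk_weight_cons u v p :
  walk_weight w u (v :: p) = w u v + walk_weight w v p.
Proof. by rewrite /walk_weight /= big_cons. Qed.

Lemma walk_weight_cat u p q :
  walk_weight w u (p ++ q) = walk_weight w u p + walk_weight w (last u p) q.
Proof.
elim: p u => [|v p IH] u /=; first by rewrite walk_weight_nil add0r.
by rewrite !walk_weight_cons IH addrA.
Qed.

(** Distances are handled through explicit walks of bounded weight: unlike a bound on [graph_dist],
    whose junk value is 0, this carries connectedness with it. *)
Definition wk H u v (r : R) : Prop :=
  exists p, [/\ path (adj H) u p, last u p = v & walk_weight w u p <= r].

Lemma wk_refl H u r : 0 <= r -> wk H u u r.
Proof. by move=> r0; exists [::]; split; rewrite ?walk_weight_nil. Qed.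

Lemma wk_le H u v r s : r <= s -> wk H u v r -> wk H u v s.
Proof. by move=> rs [p [P L W]]; exists p; split=> //; apply: le_trans rs. Qed.

Lemma wk_trans H v u x r s : wk H u v r -> wk H v x s -> wk H u x (r + s).
Proof.
move=> [p [P L W]] [q [P' L' W']]; exists (p ++ q); split.
- by rewrite cat_path P L.
- by rewrite last_cat L.
- by rewrite walk_weight_cat L lerD.
Qed.

Lemma wk_edge H u v : adj H u v -> wk H u v (w u v).
Proof.
move=> a; exists [:: v]; split; rewrite /= ?a //.
by rewrite walk_weight_cons walk_weight_nil addr0.
Qed.

Lemma wk_sub H H' u v r :
  subrel (adj H) (adj H') -> wk H u v r -> wk H' u v r.
Proof. by move=> s [p [P L W]]; exists p; split=> //; apply: sub_path P. Qed.

Lemma wk_connect H u v r : wk H u v r -> connect (adj H) u v.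
Proof. by move=> [p [P L _]]; apply/connectP; exists p. Qed.

Lemma edge_weight_sub H H' :
  subrel (adj H) (adj H') -> edge_weight H' w -> edge_weight H w.
Proof. by move=> s e u v a; apply: e; apply: s. Qed.

Section EdgeWeight.
Variable H : graph V.
Hypothesis ew : edge_weight H w.

Lemma wk_sym u v r : wk H u v r -> wk H v u r.
Proof.
move=> [p [P L W]]; elim: p u r P L W => [|x p IH] u r /=.
  by move=> _ <- W; apply: wk_refl; rewrite walk_weight_nil in W.
case/andP=> a P L; rewrite walk_weight_cons => W.
have {}W : walk_weight w x p <= r - w u x by lra.
have h := IH _ _ P L W.
have -> : r = (r - w u x) + w u x by lra.
apply: wk_trans h _; have [_ ->] := ew a.
by apply: wk_edge; rewrite adj_sym.
Qed.

Lemma walk_weight_ge0 u p : path (adj H) u p -> 0 <= walk_weight w u p.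
Proof.
elim: p u => [|x p IH] u /=; first by rewrite walk_weight_nil.
case/andP=> a P; rewrite walk_weight_cons.
by apply: addr_ge0; [have [/ltW] := ew a | apply: IH].
Qed.

(** Weights are positive, so cutting out a closed detour only shortens a walk. *)
Lemma uniq_walk u p : path (adj H) u p ->
  exists q, [/\ path (adj H) u q, last u q = last u p, uniq (u :: q)
    & walk_weight w u q <= walk_weight w u p].
Proof.
elim: p u => [|x p IH] u /=; first by exists [::].
case/andP=> a /[dup] P /IH [q [Q L U W]].
have [uq|uq] := boolP (u \in x :: q); last first.
  exists (x :: q); split=> //=; rewrite ?a ?uq //.
  by rewrite !walk_weight_cons lerD2l.
have [wux _] := ew a.
rewrite walk_weight_cons.
move: uq; rewrite inE => /orP[/eqP ux|uq].
  exists q; rewrite ux; split=> //; apply: le_trans W _.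
  by rewrite lerDr ux in wux *; apply: ltW.
case/splitPr: uq Q L U W => q1 q2.
rewrite cat_path last_cat /= => /and3P[Q1 Q2 Q3] L.
rewrite mem_cat cat_uniq /= => /and5P[_ _ _ uq2 uq3] W.
exists q2; split=> //=; first by rewrite uq2 uq3.
have := walk_weight_cat x q1 (u :: q2); rewrite walk_weight_cons.
have := walk_weight_ge0 Q1.
have [/ltW] := ew Q2.
lra.
Qed.

(** Duplicate-free walks have bounded length, hence are finitely many, so the infimum is a
    minimum. *)
Lemma gd_attained u v : connect (adj H) u v ->
  exists p, [/\ path (adj H) u p, last u p = v &
    forall q, path (adj H) u q -> last u q = v ->
     walk_weight w u p <= walk_weight w u q].
Proof.
case/connectP=> p0 P0 L0.
have [q0 [Q0 M0 U0 _]] := uniq_walk P0.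
pose n := #|V|.
have sz q : uniq (u :: q) -> (size q <= n)%N.
  by move=> /card_uniqP /= E; have := max_card [in u :: q]; rewrite E => /ltnW.
pose b0 : n.-bseq V := Bseq (sz _ U0).
pose Q (b : n.-bseq V) := path (adj H) u b && (last u b == v).
have Qb : Q b0 by rewrite /Q /= Q0 M0 -L0 eqxx.
case: (@arg_minP _ R _ b0 Q (fun b => walk_weight w u b) Qb) => b /andP[B1 /eqP B2] B3.
exists b; split=> // q P L.
have [q' [P' L' U' W']] := uniq_walk P.
apply: le_trans W'; apply: (B3 (Bseq (sz _ U'))).
by rewrite /Q /= P' L' L eqxx.
Qed.

Lemma gd_le u v r : wk H u v r -> graph_dist H w u v <= r.
Proof.
move=> [p [P L W]]; apply: le_trans W; apply: ge_inf.
  exists 0 => _ [q [Q _] <-]; exact: walk_weight_ge0.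
by exists p.
Qed.

Lemma gd_wk u v : connect (adj H) u v -> wk H u v (graph_dist H w u v).
Proof.
move=> /gd_attained[p [P L M]]; exists p; split=> //.
apply: lb_le_inf; first by exists (walk_weight w u p), p.
by move=> _ [q [Q LQ] <-]; apply: M.
Qed.

Lemma gd_ge0 u v : 0 <= graph_dist H w u v.
Proof.
have [/gd_wk[p [P _]]|n] := boolP (connect (adj H) u v).
  by apply: le_trans; apply: walk_weight_ge0.
rewrite /graph_dist; rewrite (_ : classical_sets.image _ _ = classical_sets.set0) ?inf0 //.
rewrite -classical_sets.subset0 => r [p [P L]] _; case/negP: n; apply/connectP; exists p => //.
Qed.

Lemma gd_lt_big u v : graph_dist H w u v < 1 + \sum_x \sum_y graph_dist H w x y.
Proof.
rewrite (bigD1 u) //= (bigD1 v) //=.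
set s1 := \sum_(i | _) _; set s2 := \sum_(i | _) _.
have : 0 <= s1 by apply: sumr_ge0 => ? _; apply: gd_ge0.
have : 0 <= s2 by apply: sumr_ge0 => ? _; apply: sumr_ge0 => ? _; apply: gd_ge0.
lra.
Qed.

End EdgeWeight.

(* Unlike [graph_dist], which is 0 between unconnected vertices, [ds] is a metric
   even if [H] is not connected. *)
Definition ds H u v : R :=
  if connect (adj H) u v then graph_dist H w u v
  else 1 + \sum_x \sum_y graph_dist H w x y.

Section Ds.
Variable H : graph V.
Hypothesis ew : edge_weight H w.
Local Notation d := (ds H).

Lemma ds_gd u v : connect (adj H) u v -> d u v = graph_dist H w u v.
Proof. by rewrite /ds => ->. Qed.

Lemma ds_le u v r : wk H u v r -> d u v <= r.
Proof. by move=> /[dup] h /gd_le; rewrite ds_gd //; [apply|apply: wk_connect h]. Qed.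

Lemma ds_wk u v : connect (adj H) u v -> wk H u v (d u v).
Proof. by move=> h; rewrite ds_gd //; apply: gd_wk. Qed.

Lemma ds_ge0 u v : 0 <= d u v.
Proof.
rewrite /ds; case: ifP => _; first exact: gd_ge0.
by apply: le_trans (ltW (gd_lt_big ew u v)); apply: gd_ge0.
Qed.

Lemma ds_refl u : d u u = 0.
Proof.
by apply/eqP; rewrite eq_le ds_ge0 andbT; apply: ds_le; apply: wk_refl.
Qed.

Lemma adj_connect_sym : connect_sym (adj H).
Proof. by apply: sym_connect_sym; apply: adj_sym. Qed.

Lemma ds_sym u v : d u v = d v u.
Proof.
have [c|c] := boolP (connect (adj H) u v); last first.
  by rewrite /ds [connect _ v u]adj_connect_sym (negPf c).
by apply/eqP; rewrite eq_le !ds_le //; apply: wk_sym => //; apply: ds_wk => //;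
  rewrite adj_connect_sym.
Qed.

Lemma ds_tri v u x : d u x <= d u v + d v x.
Proof.
have [c|c] := boolP (connect (adj H) u v && connect (adj H) v x).
  case/andP: c => c1 c2; apply: ds_le; apply: wk_trans (ds_wk c1) (ds_wk c2).
have hb : d u x <= 1 + \sum_x \sum_y graph_dist H w x y.
  by rewrite {1}/ds; case: ifP => // _; apply: ltW; apply: gd_lt_big.
apply: le_trans hb _.
move: c; rewrite negb_and => /orP[c|c].
  by rewrite [d u v]/ds (negPf c) lerDl ds_ge0.
by rewrite [d v x]/ds (negPf c) lerDr ds_ge0.
Qed.

Lemma ds_next u v : connect (adj H) u v -> u != v ->
  exists u', [/\ adj H u u', connect (adj H) u' v & d u v = w u u' + d u' v].
Proof.
move=> c uv; have [[|x p] [/= P L W]] := ds_wk c.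
  by rewrite L eqxx in uv.
case/andP: P => a P.
have c' : connect (adj H) x v by apply/connectP; exists p.
exists x; split=> //; apply/eqP; rewrite eq_le; apply/andP; split.
  by apply: ds_le; apply: wk_trans (wk_edge a) (ds_wk c').
apply: le_trans W; rewrite walk_weight_cons lerD2l; apply: ds_le.
by exists p.
Qed.

Lemma ds_gt0 u v : u != v -> 0 < d u v.
Proof.
move=> uv; have [c|c] := boolP (connect (adj H) u v).
  have [x [a _ ->]] := ds_next c uv; have [h _] := ew a.
  by apply: lt_le_trans h _; rewrite lerDl ds_ge0.
by apply: le_lt_trans (gd_ge0 ew u v) _; rewrite /ds (negPf c) gd_lt_big.
Qed.

Lemma ds_eq0 u v : d u v <= 0 -> u = v.
Proof. by move=> h; apply/eqP; apply: contraTT h => /ds_gt0; rewrite -ltNge. Qed.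

End Ds.

Lemma ds_sub H H' u v : edge_weight H' w -> subrel (adj H) (adj H') ->
  connect (adj H) u v -> ds H' u v <= ds H u v.
Proof.
move=> ew s c; apply: ds_le => //; apply: (wk_sub s); apply: ds_wk => //.
exact: edge_weight_sub s ew.
Qed.

End Walks.

(** * Nets and colourings *)

Section FiniteSets.
Variables (R : realType) (T : finType).

(** A separated subset that is maximal for inclusion is a net: a point far from it could be
    added. *)
Lemma net_exists (d : T -> T -> R) (X : {set T}) (r : R) : (forall x, d x x = 0) ->
  (forall x y, d x y = d y x) -> 0 <= r ->
  exists N : {set T}, [/\ N \subset X,
    {in N &, forall z z', z != z' -> r < d z z'} &
    {in X, forall v, exists2 z, z \in N & d v z <= r}].
Proof.
move=> dxx sym r0.
pose sep (A : {set T}) := (A \subset X) &&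
  [forall z in A, forall z' in A, (z != z') ==> (r < d z z')].
have sep0 : sep finset.set0.
  by rewrite /sep finset.sub0set; apply/forall_inP => z; rewrite inE.
have [N /maxsetP[/andP[NX /forall_inP Ns] Nm] _] := maxset_exists sep0.
have Ns' : {in N &, forall z z', z != z' -> r < d z z'}.
  by move=> z z' zN z'N zz'; have /forall_inP/(_ z' z'N)/implyP := Ns z zN; apply.
exists N; split=> // v vX.
have [vN|vN] := boolP (v \in N); first by exists v; rewrite ?dxx.
have [/exists_inP[z zN h]|] := boolP [exists z in N, d v z <= r]; first by exists z.
move=> /exists_inPn far; suff : v |: N = N by move=> E; rewrite -E setU11 in vN.
apply: Nm; last exact: subsetU1.
rewrite /sep subUset sub1set vX NX /=; apply/forall_inP => z /setU1P[->|zN];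
  apply/forall_inP => z' /setU1P[->|z'N]; apply/implyP => zz'.
- by rewrite eqxx in zz'.
- by rewrite ltNge; apply: far.
- by rewrite sym ltNge; apply: far.
- exact: Ns'.
Qed.

(** Greedy colouring. As [e] is reflexive on [N], the degree bound [K] counts the vertex itself,
    which is why [K] colours suffice. *)
Lemma coloring (e : rel T) (N : {set T}) K : symmetric e ->
  {in N, forall v, e v v} ->
  {in N, forall v, (#|[set u in N | e v u]| <= K)%N} ->
  exists col : T -> nat, {in N, forall v, (col v < K)%N} /\
    {in N &, forall u v, u != v -> e u v -> col u != col v}.
Proof.
move=> sym; have [m] := ubnP #|N|; elim: m N => // m IH N Nm exx deg.
have [->|[v vN]] := set_0Vmem N.
  by exists (fun=> 0%N); split=> [v|u v]; rewrite inE.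
have NvN u : u \in N :\ v -> u \in N by move=> /setD1P[].
have [|||col [colK colN]] := IH (N :\ v).
- by rewrite (cardsD1 v) vN in Nm.
- by move=> u /NvN/exx.
- move=> u /NvN/deg; apply: leq_trans; apply: subset_leq_card.
  by apply/subsetP => x; rewrite !inE => /andP[/andP[_ ->] ->].
pose used := [seq col u | u <- enum [set u in N :\ v | e v u]].
have used_lt : (size used < K)%N.
  rewrite size_map -cardE; apply: leq_trans (deg v vN); apply: proper_card.
  apply/properP; split; last by exists v; rewrite !inE ?eqxx ?vN ?exx.
  by apply/subsetP => x; rewrite !inE => /andP[/andP[_ ->] ->].
have [/allP all_used|] := boolP (all (mem used) (iota 0 K)).
  have := uniq_leq_size (iota_uniq 0 K) all_used.
  by rewrite size_iota leqNgt used_lt.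
case/allPn => c; rewrite mem_iota /= add0n => cK cN.
have fresh u : u \in N -> u != v -> e v u -> col u != c.
  move=> uN uv evu; apply: contraNneq cN => <-; apply: map_f.
  by rewrite mem_enum !inE uv uN evu.
exists (fun u => if u == v then c else col u); split.
  by move=> u uN; case: (eqVneq u v) => // uv; apply: colK; rewrite !inE uv.
move=> u u' uN u'N uu' eu; case: (eqVneq u v) => [E|uv]; case: (eqVneq u' v) => [E'|u'v].
- by rewrite E E' eqxx in uu'.
- by rewrite eq_sym; apply: fresh => //; rewrite -E.
- by apply: fresh => //; rewrite sym -E'.
- by apply: colN; rewrite ?inE ?uv ?u'v.
Qed.

Lemma min_distance (d : T -> T -> R) : (forall x y, x != y -> 0 < d x y) ->
  exists2 m, 0 < m & forall x y, x != y -> m <= d x y.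
Proof.
move=> pos; have [[a b] /= ab|no] := pickP (fun p : T * T => p.1 != p.2).
  case: (@arg_minP _ R _ (a, b) (fun p : T * T => p.1 != p.2)
    (fun p => d p.1 p.2) ab) => -[x y] /= xy h.
  by exists (d x y); [apply: pos|move=> u v uv; apply: (h (u, v))].
by exists 1 => // x y xy; have := no (x, y); rewrite /= xy.
Qed.

Lemma halving_lt (a b : R) : 0 < b -> exists n, a / 2 ^+ n < b.
Proof.
move=> b0; exists (Num.bound (a / b)).
rewrite ltr_pdivrMr ?exprn_gt0 // mulrC -ltr_pdivrMr //.
have [ab|ab] := ltP (a / b) 0; first by apply: lt_le_trans ab _; rewrite exprn_ge0.
apply: lt_trans (archi_boundP ab) _.
by rewrite -natrX ltr_nat ltn_expl.
Qed.

End FiniteSets.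

Section Induced.
Variables (V : finType) (G : graph V) (X : {set V}).

Definition induced_adj : rel V := fun u v => [&& u \in X, v \in X & adj G u v].

Lemma induced_sym : symmetric induced_adj.
Proof. by move=> u v; rewrite /induced_adj adj_sym andbCA. Qed.

Lemma induced_irr : irreflexive induced_adj.
Proof. by move=> u; rewrite /induced_adj adj_irr !andbF. Qed.

Definition induced_graph : graph V := Graph induced_sym induced_irr.

Lemma induced_sub : subrel (adj induced_graph) (adj G).
Proof. by move=> u v /and3P[]. Qed.

End Induced.

(** * Strands inside a cluster *)

Section Skeleton.
Variables (R : realType) (V : finType) (w : V -> V -> R) (G : graph V).
Hypothesis ewG : edge_weight G w.
Variable X : {set V}.
Local Notation dX := (ds w (induced_graph G X)).

Let ewX : edge_weight (induced_graph G X) w.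
Proof. by apply: edge_weight_sub ewG; apply: induced_sub. Qed.

Let ge0 := ds_ge0 ewX.
Let dxx := ds_refl ewX.
Let sym := ds_sym ewX.
Let tri := ds_tri ewX.

Hypothesis conX : {in X &, forall u v, connect (adj (induced_graph G X)) u v}.

(** A shortest path from [z] to [e] is followed up to the first vertex [a] that satisfies [P]; [Q]
    is the part before [a]. The last clause holds for every [nx'] that agrees with [n] on [Q], since
    the pointers elsewhere are chosen later. *)
Lemma strand (P : pred V) (e z : V) : z \in X -> e \in X -> P e -> ~~ P z ->
  exists (Q : {set V}) (n : V -> V) (a : V),
  [/\ z \in Q, a \in X, P a,
     forall f, f \in Q ->
      [/\ f \in X, ~~ P f, adj G f (n f), dX z e = dX z f + dX f e &
         dX f e = dX f a + dX a e] &
     (forall T : graph V, (forall f, f \in Q -> adj T f (n f)) ->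
       edge_weight T w ->
       {in Q &, forall f f', wk w T f f' (dX f f')} /\
       {in Q, forall f, wk w T f a (dX f a)}) /\
     (forall nx', {in Q, forall f, nx' f = n f} ->
       {in Q, forall f, exists k, iter k nx' f = a})].
Proof.
have [m] := ubnP #|[set x | dX x e < dX z e]|.
elim: m z => // m IH z; rewrite ltnS => lem zX eX Pe Pz.
have ze : z != e by apply: contraNneq Pz => ->.
have [z' [/and3P[_ z'X az] _ dz]] := ds_next ewX (conX zX eX) ze.
have [wz _] := ewG az.
have wd : dX z z' = w z z'.
  apply/eqP; rewrite eq_le; apply/andP; split.
    by apply: ds_le => //; apply: wk_edge; rewrite /= /induced_adj zX z'X.
  by have := tri z' z e; lra.
case Pz': (P z').
  exists [set z], (fun=> z'), z'; split=> //; first by rewrite inE.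
    by move=> f /set1P ->; split=> //; rewrite ?dxx; lra.
  split=> [T Tn ewT|nx' E].
    have Tz : wk w T z z' (dX z z').
      by rewrite wd; apply: wk_edge; apply: Tn; rewrite inE.
    split=> [f f' /set1P -> /set1P ->|f /set1P -> //].
    by rewrite dxx; apply: wk_refl.
  by move=> f fz; exists 1%N; rewrite /= E.
have [|Q [n [a [z'Q aX Pa Qf [QT Qn]]]]] := IH z' _ z'X eX Pe (negbT Pz').
  apply: leq_trans lem; apply: proper_card; apply/properP; split.
    by apply/subsetP => x; rewrite !inE => h; apply: lt_trans h _; lra.
  by exists z'; rewrite inE ?ltxx //; lra.
have zQ : z \notin Q.
  by apply/negP => /Qf[_ _ _ E _]; have := ge0 z' z; lra.
pose n' f := if f == z then z' else n f.
have n'E f : f \in Q -> n' f = n f.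
  by move=> fQ; rewrite /n' ifN //; apply: contraNneq zQ => <-.
have az' : dX z' e = dX z' a + dX a e by have [] := Qf _ z'Q.
have zf f : f \in Q -> dX z f = w z z' + dX z' f.
  move=> fQ; have [_ _ _ E _] := Qf _ fQ.
  by have := tri f z e; have := tri z' z f; lra.
have za : dX z a = w z z' + dX z' a.
  by have := tri a z e; have := tri z' z a; lra.
exists (z |: Q), n', a; split=> //; first by rewrite !inE eqxx.
  move=> f /setU1P[->|fQ].
    by split=> //; rewrite /n' ?eqxx // ?dxx; lra.
  have [? ? ? E1 E2] := Qf _ fQ; split=> //; rewrite ?n'E //.
  by rewrite dz zf // E1; lra.
split=> [T Tn ewT|nx' E].
  have [T1 T2] := QT T
    (fun f fQ => etrans (f_equal _ (esym (n'E f fQ))) (Tn f (setU1r _ fQ))) ewT.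
  have Tz : wk w T z z' (w z z').
    by apply: wk_edge; have := Tn z (setU11 _ _); rewrite /n' eqxx.
  have T3 f : f \in Q -> wk w T z f (dX z f).
    by move=> fQ; rewrite zf //; apply: wk_trans Tz _; apply: T1.
  split.
    move=> f f' /setU1P[->|fQ] /setU1P[->|fQ'].
    - by rewrite dxx; apply: wk_refl.
    - exact: T3.
    - by rewrite sym; apply: wk_sym => //; apply: T3.
    - exact: T1.
  move=> f /setU1P[->|fQ]; last exact: T2.
  by rewrite za; apply: wk_trans Tz _; apply: T2.
move=> f /setU1P[->|fQ].
  have [|k Ek] := Qn nx' _ z' z'Q.
    by move=> g gQ; rewrite E ?n'E // !inE gQ orbT.
  by exists k.+1; rewrite iterSr E ?setU11 // /n' eqxx.
by apply: Qn fQ => g gQ; rewrite E ?n'E // !inE gQ orbT.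
Qed.

(** * Partial forests and the laying of one strand *)

Variables (un : V -> {set V}) (rad : V -> R) (S : {set V}).
Hypothesis un_refl : {in X, forall v, v \in un v}.
Hypothesis un_eq : forall u v, v \in X -> u \in un v -> un u = un v.

(* A partially built forest: [cov] is the union of [S] and of the strands laid so
   far, [nx] points along each strand towards its port, and [lab] names a strand
   by its first vertex ([None] for [S]). *)
Record state := State { cov : {set V}; nx : V -> V; lab : V -> option V }.

(** [un v] is the lower cluster, or unit, of [v]. Strands stop on reaching an owned unit, so that a
    unit meets only [S] or a single strand. *)
Definition owned (st : state) (v : V) := [exists f in cov st, un f == un v].

Lemma ownedP st v :
  reflect (exists2 f, f \in cov st & un f = un v) (owned st v).
Proof.
by apply: (iffP exists_inP) => -[f fC /eqP E]; exists f => //; apply/eqP.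
Qed.

Lemma cov_owned st v : v \in cov st -> owned st v.
Proof. by move=> vC; apply/ownedP; exists v. Qed.

Lemma owned_un st u v : un u = un v -> owned st u -> owned st v.
Proof. by move=> E /ownedP[f fC Ef]; apply/ownedP; exists f => //; rewrite Ef. Qed.

(* [T] contains the strands of [st] and does not stretch [S]. *)
Record carries (st : state) (T : graph V) : Prop := Carries {
  adm_sub : subrel (adj T) (adj G);
  adm_nx : forall f, f \in cov st -> f \notin S -> adj T f (nx st f);
  adm_S : {in S &, forall s s', wk w T s s' (dX s s')} }.

(* Moreover [T] connects every vertex of an owned unit to the strand that owns
   this unit. *)
Record admissible (st : state) (T : graph V) : Prop := Admissible {
  adm_carries :> carries st T;
  adm_hop : forall v, v \in X -> owned st v ->
    exists f, [/\ f \in cov st, un f = un v & wk w T v f (32 * rad v)] }.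

Lemma car_ew st T : carries st T -> edge_weight T w.
Proof. by move=> /adm_sub s; apply: edge_weight_sub ewG. Qed.

Lemma adm_ew st T : admissible st T -> edge_weight T w.
Proof. by move=> /adm_carries/car_ew. Qed.

(** In [val_lead], a strand ends at a port whose unit is owned but which need not be covered itself;
    the pointers inside that unit, still to be chosen, must lead from the port back to the forest.
    [val_iso] asks only for [carries]: it feeds the recursion inside the units, from which
    [admissible] is derived afterwards. *)
Record valid (st : state) : Prop := Valid {
  val_S : S \subset cov st;
  val_X : cov st \subset X;
  val_lab : {in cov st &, forall f f', un f = un f' -> lab st f = lab st f'};
  val_None : forall f, f \in cov st -> lab st f = None -> f \in S;
  val_Some : forall f z, f \in cov st -> lab st f = Some z -> z \in cov st;
  val_adj : forall f, f \in cov st -> f \notin S -> adj G f (nx st f);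
  val_lead : forall nx', (forall f, f \in cov st -> f \notin S -> nx' f = nx st f) ->
    (forall v, v \in X -> owned st v ->
       exists k, (iter k nx' v \in cov st) && (un (iter k nx' v) == un v)) ->
    forall f, f \in cov st -> exists k, iter k nx' f \in S;
  val_iso : forall T, carries st T ->
    {in cov st &, forall f f', lab st f = lab st f' -> wk w T f f' (dX f f')} }.

(** By [ext_owned] new strands avoid the units already owned; this is what makes admissibility pass
    down to earlier states. *)
Record extends (st st' : state) : Prop := Extends {
  ext_cov : cov st \subset cov st';
  ext_nx : {in cov st, nx st' =1 nx st};
  ext_lab : {in cov st, lab st' =1 lab st};
  ext_owned : forall f, f \in cov st' -> owned st f -> f \in cov st }.

Lemma ext_refl st : extends st st. Proof. by split. Qed.

Lemma ext_in st st' f : extends st st' -> f \in cov st -> f \in cov st'.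
Proof. by move=> /ext_cov/subsetP; apply. Qed.

Lemma owned_ext st st' v : extends st st' -> owned st v -> owned st' v.
Proof. by move=> x /ownedP[f /(ext_in x) fC E]; apply/ownedP; exists f. Qed.

Lemma ext_trans st2 st1 st3 : extends st1 st2 -> extends st2 st3 -> extends st1 st3.
Proof.
move=> x y; split.
- exact: subset_trans (ext_cov x) (ext_cov y).
- by move=> f fC; rewrite (ext_nx y) ?(ext_nx x) //; apply: ext_in fC.
- by move=> f fC; rewrite (ext_lab y) ?(ext_lab x) //; apply: ext_in fC.
- move=> f fC o; apply: (ext_owned x) => //; apply: (ext_owned y) => //.
  exact: owned_ext o.
Qed.

Lemma car_ext st st' T : extends st st' -> carries st' T -> carries st T.
Proof.
move=> x [s n i]; split=> // f fC fS.
by rewrite -(ext_nx x) //; apply: n fS; apply: ext_in fC.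
Qed.

Lemma adm_ext st st' T : extends st st' -> admissible st' T -> admissible st T.
Proof.
move=> x [c h]; split=> [|v vX o]; first exact: car_ext x c.
have [f [fC' E W]] := h v vX (owned_ext x o); exists f; split=> //.
by apply: (ext_owned x) => //; apply: owned_un o.
Qed.

(* [a] is the port at which the strand laid from [z] towards [e] ends. *)
Definition laid (st st' : state) (z e : V) : Prop := exists a,
  [/\ a \in X, owned st a, z \in cov st' &
     forall f, f \in cov st' -> f \notin cov st ->
     [/\ lab st' f = Some z, dX z e = dX z f + dX f e,
         dX f e = dX f a + dX a e &
         forall T, admissible st' T -> wk w T f a (dX f a)]].

(** The strand is stopped at the first owned vertex, so it enters no owned unit. Its label is fresh:
    labels in use name covered vertices, and [z] is not covered. *)
Lemma lay st z e : valid st -> z \in X -> e \in X -> owned st e ->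
  exists st', [/\ valid st', extends st st', owned st' z &
    if owned st z then st' = st else laid st st' z e].
Proof.
move=> vst zX eX oe; have [oz|oz] := boolP (owned st z).
  by exists st; split=> //; apply: ext_refl.
have [Q [n [a [zQ aX oa Qf [QT Qn]]]]] := strand (P := owned st) zX eX oe oz.
have QC f : f \in Q -> f \notin cov st.
  by case/Qf => _ o _ _ _; apply: contra o; apply: cov_owned.
pose st' := State (cov st :|: Q) (fun f => if f \in Q then n f else nx st f)
  (fun f => if f \in Q then Some z else lab st f).
have CQ f : f \in cov st -> f \in Q = false.
  by move=> fC; apply/negP => /QC; rewrite fC.
have SC f : f \in S -> f \in cov st by move=> fS; have /subsetP := val_S vst; apply.
have SQ f : f \in Q -> f \notin S by move=> /QC; apply: contra; apply: SC.
have x : extends st st'.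
  split=> /=.
  - exact: subsetUl.
  - by move=> f fC; rewrite /= CQ.
  - by move=> f fC; rewrite /= CQ.
  - by move=> f /setUP[//|/Qf[_ /negP o _ _ _] /o].
have A T : carries st' T -> {in Q &, forall f f', wk w T f f' (dX f f')} /\
       {in Q, forall f, wk w T f a (dX f a)}.
  move=> aT; apply: QT (car_ew aT) => f fQ; move: (adm_nx aT) => /(_ f).
  by rewrite /= inE fQ orbT; apply; rewrite // SQ.
exists st'; split=> //.
- split=> /=.
  + by apply: subset_trans (val_S vst) _; apply: subsetUl.
  + apply/subsetP => f /setUP[|/Qf[]//]; exact: (subsetP (val_X vst)).
  + move=> f f' /setUP[fC|fQ] /setUP[fC'|fQ'] E.
    * by rewrite !CQ //; apply: (val_lab vst).
    * by case: (Qf _ fQ') => _ /ownedP[]; exists f.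
    * by case: (Qf _ fQ) => _ /ownedP[]; exists f'.
    * by rewrite fQ fQ'.
  + move=> f /setUP[fC|->//]; rewrite CQ //; exact: (val_None vst).
  + move=> f z' /setUP[fC|fQ].
      by rewrite CQ // => /(val_Some vst fC); rewrite inE => ->.
    by rewrite fQ => -[<-]; rewrite inE zQ orbT.
  + move=> f /setUP[fC fS|fQ fS]; last by rewrite fQ; have [] := Qf _ fQ.
    by rewrite CQ //; apply: (val_adj vst).
  (* From a new vertex the pointers follow the strand to its port [a], then the unit of [a] to an
     old covered vertex, then the old forest to [S]. *)
  + move=> nx' E h.
    have h1 f : f \in cov st -> exists k, iter k nx' f \in S.
      apply: (val_lead vst) => [g gC gS|v vX o].
        by rewrite E ?CQ // inE gC.
      have [k /andP[kC /eqP kE]] := h v vX (owned_ext x o).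
      exists k; rewrite kE eqxx andbT.
      by apply: (ext_owned x) => //; apply: owned_un o.
    move=> f /setUP[/h1 //|fQ].
    have [|k Ek] := Qn nx' _ f fQ.
      by move=> g gQ; rewrite E ?gQ ?SQ // inE gQ orbT.
    have [k' /andP[k'C /eqP k'E]] := h a aX (owned_ext x oa).
    have [|k2 E2] := h1 (iter k' nx' a).
      by apply: (ext_owned x) => //; apply: owned_un oa.
    by exists (k2 + (k' + k))%N; rewrite !iterD Ek.
  + move=> T aT; have [A1 A2] := A T aT.
    move=> f f' /setUP[fC|fQ] /setUP[fC'|fQ'].
    * rewrite !CQ //; exact: (val_iso vst (car_ext x aT)).
    * by rewrite CQ // fQ' => /(val_Some vst fC); rewrite (negPf (QC _ zQ)).
    * by rewrite fQ CQ // => /esym/(val_Some vst fC'); rewrite (negPf (QC _ zQ)).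
    * by move=> _; apply: A1.
- by apply: cov_owned; rewrite inE zQ orbT.
- exists a; split=> //; first by rewrite inE zQ orbT.
  move=> f /setUP[->//|fQ] _; have [_ _ _ E1 E2] := Qf _ fQ; split=> //=.
    by rewrite fQ.
  by move=> T [/A[_ h _]]; apply: h.
Qed.

(** * Joining a chosen pair to [S] with little stretch *)

Hypothesis SX : S \subset X.
Variables (eta sg rho : R).
Hypothesis eta_sg : eta <= sg.
Hypothesis sg_rho : sg <= rho.
Hypothesis diamX : {in X &, forall u v, dX u v <= 5 * rho}.
Hypothesis un_diam : forall u v, v \in X -> u \in un v -> dX v u <= 5 * rad v.
Hypothesis rad_ge0 : forall v, 0 <= rad v.
Hypothesis rad_le : {in X, forall v, 32 * rad v <= eta}.
Variable s0 : V.
Hypothesis s0S : s0 \in S.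

Let rad_sg : {in X, forall v, 32 * rad v <= sg}.
Proof. by move=> v vX; apply: le_trans (rad_le vX) eta_sg. Qed.

(** A walk of [T] may leave [X], so it does not bound [dX]; both bounds are carried along. *)
Definition cl (T : graph V) u v (r : R) := wk w T u v r /\ dX u v <= r.

Lemma cl_trans T v u x r s : cl T u v r -> cl T v x s -> cl T u x (r + s).
Proof.
move=> [a b] [c e]; split; first exact: wk_trans a c.
by have := tri v u x; lra.
Qed.

Lemma cl_le T u v r s : r <= s -> cl T u v r -> cl T u v s.
Proof. by move=> rs [a b]; split; [apply: wk_le a|apply: le_trans rs]. Qed.

Lemma covX st v : valid st -> v \in cov st -> v \in X.
Proof. by move=> /val_X/subsetP; apply. Qed.

Lemma sg_ge0 : 0 <= sg.
Proof.
have := rad_ge0 s0; have := rad_sg (subsetP SX _ s0S); lra.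
Qed.

Lemma hop st T v : valid st -> admissible st T -> v \in X -> owned st v ->
  exists f, [/\ f \in cov st, un f = un v & cl T v f sg].
Proof.
move=> vs aT vX o; have [f [fC E W]] := adm_hop aT vX o.
exists f; split=> //; split; first by apply: wk_le W; apply: rad_sg.
have /(un_diam vX) : f \in un v by rewrite -E un_refl //; apply: covX fC.
by have := rad_ge0 v; have := rad_sg vX; lra.
Qed.

Definition start : state := State S id (fun=> None).

Lemma start_valid : valid start.
Proof.
split=> //=.
- by move=> f ->.
- by move=> nx' _ _ f fS; exists 0%N.
- by move=> T aT f f' fS f'S _; apply: (adm_S aT).
Qed.

Lemma laid_length st st' z e T f : valid st -> extends st st' ->
  valid st' ->
  z \in X -> e \in X -> laid st st' z e -> admissible st' T ->
  f \in cov st' -> f \notin cov st ->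
  exists2 g, g \in cov st & wk w T f g (5 * rho + sg).
Proof.
move=> vs x vs' zX eX [a [aX oa zC h]] aT fC fN.
have [_ E1 E2 /(_ T aT) W] := h f fC fN.
have [g [gC _ [W' _]]] := hop vs (adm_ext x aT) aX oa.
exists g => //; apply: wk_trans W'; apply: wk_le W.
exact: diamX (covX vs' fC) aX.
Qed.

Lemma nearestP (A : {set V}) (a0 v : V) : a0 \in A ->
  exists2 e, e \in A & forall g, g \in A -> dX v e <= dX v g.
Proof.
move=> aA; case: (@arg_minP _ R _ a0 (mem A) (fun g => dX v g) aA) => e eA h.
by exists e.
Qed.

(* The state reached once [x] is attached to [S], as seen from the vertex [a]
   at which the shortest paths from [x] to [y] first come close to [S]. *)
Record half_stage (x y : V) (st : state) (a : V) : Prop := HalfStage {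
  hs_valid : valid st;
  hs_ext : extends start st;
  hs_x : owned st x;
  hs_a : owned st a;
  hs_aX : a \in X;
  hs_between : dX x a + dX a y = dX x y;
  hs_far : forall T f b, admissible st T -> f \in cov st -> b \in X ->
    dX a b + dX b y = dX a y -> dX b f <= 7 * sg ->
    wk w T x f (dX x b + 62 * sg);
  hs_near_x : forall T f, admissible st T -> f \in cov st -> dX f x <= 6 * sg ->
    wk w T f x (100 * sg);
  hs_near_y : forall T f f', admissible st T -> f \in cov st -> f' \in cov st ->
    dX f y <= 7 * sg -> dX f' y <= 7 * sg -> wk w T f f' (114 * sg);
  hs_S : forall T f, admissible st T -> f \in cov st ->
    exists2 s, s \in S & wk w T f s (12 * rho) }.

(** One strand from [x] to [S] is enough: as [S] stays away from the shortest paths from [x] to [y],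
    any covered vertex close to such a path lies on this strand, where distances are exact. *)
Lemma half_stage_far x y : x \in X -> y \in X ->
  (forall p s, p \in X -> s \in S -> dX x p + dX p y = dX x y -> 8 * sg < dX p s) ->
  exists st, half_stage x y st x.
Proof.
move=> xX yX far; have sg0 := sg_ge0; have sgr := sg_rho.
have [e eS _] := nearestP x s0S.
have eX : e \in X by apply: (subsetP SX).
have [st [vst xst ost]] := lay start_valid xX eX (@cov_owned start e eS).
case: ifPn => [/ownedP[f fS uf] _|ox ls].
  have := far x f xX fS; rewrite dxx add0r => /(_ erefl).
  have /(un_diam xX) : f \in un x by rewrite -uf un_refl //; apply: (subsetP SX).
  by have := rad_sg xX; have := rad_ge0 x; lra.
have [a [aX oa xC h]] := ls.
have lx : lab st x = Some x by have [] := h x xC; last by []; apply: contra ox => /cov_owned.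
have W T f : admissible st T -> f \in cov st -> f \notin S -> wk w T f x (dX f x).
  by move=> aT fC fS; apply: (val_iso vst aT) => //; have [-> *] := h f fC fS.
exists st; split=> //.
- by rewrite dxx add0r.
- move=> T f b aT fC bX E bf; have [fS|fS] := boolP (f \in S).
    by have := far b f bX fS E; lra.
  apply: wk_sym; first exact: adm_ew aT.
  apply: wk_le (W T f aT fC fS); have := tri b f x; rewrite (sym f b) (sym b x).
  by lra.
- move=> T f aT fC fx; have [fS|fS] := boolP (f \in S).
    by have := far x f xX fS; rewrite dxx add0r => /(_ erefl); rewrite sym; lra.
  by apply: wk_le (W T f aT fC fS); lra.
- move=> T f f' aT fC fC' fy fy'.
  have ny g : g \in cov st -> dX g y <= 7 * sg -> g \notin S.
    move=> gC gy; apply/negP => gS; have := far y g yX gS.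
    by rewrite dxx addr0 => /(_ erefl); rewrite sym; lra.
  have E g : g \in cov st -> dX g y <= 7 * sg -> lab st g = Some x.
    by move=> gC gy; have [] := h g gC (ny g gC gy).
  have := val_iso vst aT fC fC'; rewrite !E // => /(_ erefl); apply: wk_le.
  by have := tri y f f'; rewrite (sym y f'); lra.
- move=> T f aT fC; have [fS|fS] := boolP (f \in S).
    by exists f => //; apply: wk_refl; lra.
  have [g gS Wg] := laid_length start_valid xst vst xX eX ls aT fC fS.
  by exists g => //; apply: wk_le Wg; lra.
Qed.

(** Distances within [S] are not stretched, so a detour through [S] costs only O([sg]). A first
    strand joins [a] to its nearest point of [S], and a second one leads from [x] towards [a]. By
    the choice of [a], no vertex that lies between [x] and [y] and is nearer to [x] is close to
    [S]. *)
Lemma half_stage_close x y a s1 : x \in X -> y \in X -> a \in X -> s1 \in S ->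
  dX a s1 <= 8 * sg -> dX x a + dX a y = dX x y ->
  (forall p s, p \in X -> s \in S -> dX x p + dX p y = dX x y ->
     dX p s <= 8 * sg -> dX x a <= dX x p) ->
  exists st, half_stage x y st a.
Proof.
move=> xX yX aX s1S as1 xay amin; have sg0 := sg_ge0; have sgr := sg_rho.
have inX s : s \in S -> s \in X by apply: (subsetP SX).
have [e eS emin] := nearestP a s1S.
have ae : dX a e <= 8 * sg by apply: le_trans (emin _ s1S) as1.
have oe := @cov_owned start e eS.
have [st1 [v1 x1 o1 l1]] := lay start_valid aX (inX _ eS) oe.
have lab1 f : f \in cov st1 -> f \notin S -> lab st1 f = Some a /\ a \in cov st1.
  move: l1; case: ifPn => [_ -> /= -> //|oa [p [_ _ aC h]] fC fS].
  by have [-> _ _ _] := h f fC fS.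
have near1 T f : admissible st1 T -> f \in cov st1 -> f \notin S -> cl T f a (8 * sg).
  move=> aT fC fS; have [lf aC] := lab1 f fC fS.
  move: l1; case: ifPn => [_ E|oa [p [_ _ _ h]]]; first by rewrite E /= (negPf fS) in fC.
  have [_ E _ _] := h f fC fS; have d : dX f a <= 8 * sg.
    by have := ge0 f e; rewrite (sym f a); lra.
  split=> //; apply: wk_le d _; apply: (val_iso v1 aT) => //.
  by have [-> _ _ _] := h a aC (contra (@cov_owned start a) oa).
have near1S T : admissible st1 T -> exists2 sa, sa \in S & cl T a sa (9 * sg).
  move=> aT; have aT0 := adm_ext x1 aT.
  move: l1; case: ifPn => [oa _|oa [p [pX op aC h]]].
    have [f [fS _ c]] := hop start_valid aT0 aX oa.
    by exists f => //; apply: cl_le c; lra.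
  have [_ _ E W] := h a aC (contra (@cov_owned start a) oa).
  have [f [fS _ c]] := hop start_valid aT0 pX op.
  exists f => //; have -> : 9 * sg = 8 * sg + sg by lra.
  apply: cl_trans c; have d : dX a p <= 8 * sg by have := ge0 p e; lra.
  by split=> //; apply: wk_le d (W T aT).
have [st2 [v2 x2 o2 l2]] := lay v1 xX aX o1.
(* [p] is the port of the strand from [x], or [x] itself if it was owned already, and [sp] is a
   point of [S] near [p]. *)
have port T : admissible st2 T -> exists p sp, [/\ p \in X, sp \in S,
    wk w T x p (dX x p) /\ dX x p + dX p a = dX x a, cl T p sp (18 * sg) &
    forall f, f \in cov st2 -> f \notin cov st1 ->
      [/\ wk w T f p (dX f p), dX x a = dX x f + dX f a,
          dX f a = dX f p + dX p a, lab st2 f = Some x & wk w T x f (dX x f)]].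
  move=> aT2; have aT1 := adm_ext x2 aT2; have [sa saS asa] := near1S T aT1.
  have toS p : p \in X -> owned st1 p -> exists2 sp, sp \in S & cl T p sp (18 * sg).
    move=> pX op; have [f [fC _ c]] := hop v1 aT1 pX op.
    have [fS|fS] := boolP (f \in S); first by exists f => //; apply: cl_le c; lra.
    exists sa => //; have -> : 18 * sg = sg + 8 * sg + 9 * sg by lra.
    by apply: cl_trans asa; apply: cl_trans c _; apply: near1.
  move: l2; case: ifPn => [ox E|ox [p [pX op xC h]]].
    have [sx sxS c] := toS x xX ox; exists x, sx; split=> //.
      by split; [rewrite dxx; apply: wk_refl|rewrite dxx add0r].
    by rewrite E => f ->.
  have [sp spS c] := toS p pX op; have xN := contra (@cov_owned st1 x) ox.
  have [lx _ E1 W1] := h x xC xN.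
  exists p, sp; split=> //; first by split; [apply: W1|lra].
  move=> f fC fN; have [lf E2 E3 W] := h f fC fN; split=> //; first exact: W.
  by apply: (val_iso v2 aT2); rewrite // lx lf.
exists st2; split=> //.
- exact: ext_trans x1 x2.
- exact: owned_ext x2 o1.
- move=> T f b aT fC bX aby bf; have aT1 := adm_ext x2 aT.
  have xb : dX x a + dX a b <= dX x b by have := tri b x y; lra.
  have [p [sp [pX spS [W1 E1] c1 h]]] := port T aT.
  have [fC1|fC1] := boolP (f \in cov st1); last first.
    have [_ _ _ _ W] := h f fC fC1; apply: wk_le W.
    by have := tri b x f; lra.
  have pb := tri a p b.
  have [fS|fS] := boolP (f \in S).
    apply: (wk_le (r := dX x p + 18 * sg + dX sp f)).
      have [_ d1] := c1; have := tri b p f; have := tri p sp f; rewrite (sym sp p).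
      by lra.
    apply: wk_trans (adm_S aT spS fS); exact: wk_trans W1 c1.1.
  have [sa saS asa] := near1S T aT1; have [Wf df] := near1 T f aT1 fC1 fS.
  apply: (wk_le (r := dX x p + 18 * sg + dX sp sa + 9 * sg + 8 * sg)).
    have [_ d1] := c1; have [_ d2] := asa; have := ge0 a b.
    by have := tri p sp sa; have := tri a p sa; rewrite (sym sp p); lra.
  apply: wk_trans (wk_sym (adm_ew aT) Wf).
  apply: wk_trans (wk_sym (adm_ew aT) asa.1).
  apply: wk_trans (adm_S aT spS saS); exact: wk_trans W1 c1.1.
- move=> T f aT fC fx; have aT1 := adm_ext x2 aT; have ewT := adm_ew aT.
  have [p [sp [pX spS [W1 E1] c1 h]]] := port T aT.
  have [fC1|fC1] := boolP (f \in cov st1); last first.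
    have [_ _ _ _ W] := h f fC fC1; apply: wk_sym => //; apply: wk_le W.
    by rewrite sym; lra.
  have [sa saS asa] := near1S T aT1.
  have [fS|fS] := boolP (f \in S).
    (* Here [x] itself is close to [S], so the minimality of [a] forces [a = x]. *)
    have ax : a = x.
      apply: esym; apply: (ds_eq0 ewX); rewrite -(dxx x); apply: amin xX fS _ _.
        by rewrite dxx add0r.
      by rewrite sym; lra.
    apply: (wk_le (r := dX f sa + 9 * sg)).
      have [_ d] := asa; rewrite ax in d.
      by have := tri x f sa; lra.
    by rewrite -ax; apply: wk_trans (adm_S aT fS saS) _; apply: wk_sym asa.1.
  have [Wf df] := near1 T f aT1 fC1 fS; apply: wk_sym => //.
  apply: (wk_le (r := dX x p + 18 * sg + dX sp sa + 9 * sg + 8 * sg)).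
    have [_ d1] := c1; have [_ d2] := asa; have := tri f x a; rewrite (sym x f).
    by have := tri p sp sa; have := tri a p sa; rewrite (sym sp p); lra.
  apply: wk_trans (wk_sym (adm_ew aT) Wf).
  apply: wk_trans (wk_sym (adm_ew aT) asa.1).
  apply: wk_trans (adm_S aT spS saS); exact: wk_trans W1 c1.1.
- move=> T f f' aT; have aT1 := adm_ext x2 aT; have ewT := adm_ew aT.
  have [p [sp [pX spS [W1 E1] c1 h]]] := port T aT.
  have [sa saS asa] := near1S T aT1.
  have toS g : g \in cov st2 -> dX g y <= 7 * sg ->
      exists2 s, s \in S & cl T g s (25 * sg).
    move=> gC gy; have [gC1|gN] := boolP (g \in cov st1); last first.
      have [W E2 E3 _ _] := h g gC gN; exists sp => //.
      have -> : 25 * sg = 7 * sg + 18 * sg by lra.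
      apply: cl_trans c1; have d : dX g p <= 7 * sg.
        by have := tri g x y; have := ge0 p a; have := ge0 a y; lra.
      by split=> //; apply: wk_le W.
    have [gS|gS] := boolP (g \in S).
      exists g => //; split; last by rewrite dxx; lra.
      by apply: wk_refl; lra.
    exists sa => //; apply: (cl_le (r := 8 * sg + 9 * sg)); first by lra.
    by apply: cl_trans asa; apply: near1.
  move=> fC fC' fy fy'.
  have [s sS [W2 d2]] := toS f fC fy; have [s' sS' [W3 d3]] := toS f' fC' fy'.
  apply: (wk_le (r := 25 * sg + dX s s' + 25 * sg)).
    have := tri f s s'; have := tri f' f s'; have := tri y f f'.
    by rewrite (sym s f) (sym y f'); lra.
  by apply: wk_trans (wk_sym ewT W3); apply: wk_trans W2 _; apply: adm_S aT _ _ sS sS'.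
- move=> T f aT fC; have aT1 := adm_ext x2 aT.
  have f1 g : g \in cov st1 -> exists2 s, s \in S & wk w T g s (5 * rho + sg).
    move=> gC; have [gS|gS] := boolP (g \in S).
      by exists g => //; apply: wk_refl; lra.
    move: l1; case: ifPn => [_ E|oa l]; first by rewrite E /= (negPf gS) in gC.
    exact: laid_length start_valid x1 v1 aX (inX _ eS) l aT1 gC gS.
  have [fC1|fC1] := boolP (f \in cov st1).
    by have [s sS W] := f1 f fC1; exists s => //; apply: wk_le W; lra.
  move: l2; case: ifPn => [_ E|ox l]; first by rewrite E (negPf fC1) in fC.
  have [g gC Wg] := laid_length v1 x2 v2 xX aX l aT fC fC1.
  have [s sS W] := f1 g gC; exists s => //.
  by apply: wk_le (wk_trans Wg W); lra.
Qed.

Lemma half_stageP x y : x \in X -> y \in X -> exists st a, half_stage x y st a.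
Proof.
move=> xX yX.
pose close p := [&& p \in X, dX x p + dX p y == dX x y &
  [exists s in S, dX p s <= 8 * sg]].
have [p0 p0c|no] := pickP close; last first.
  have [|st h] := half_stage_far xX yX; last by exists st, x.
  move=> p s pX sS E; rewrite ltNge; apply/negP => d.
  have := no p; rewrite /close pX E eqxx /= => /exists_inP[]; by exists s.
case: (@arg_minP _ R _ p0 close (fun p => dX x p) p0c) => a.
case/and3P=> aX /eqP E /exists_inP[s sS d] amin.
have [|st h] := half_stage_close xX yX aX sS d E; last by exists st, a.
move=> p s' pX sS' E' d'; apply: amin.
by rewrite /close pX E' eqxx; apply/exists_inP; exists s'.
Qed.

(** The second half starts from [a] and treats the forest built so far as the first half treats [S]:
    [b] is the vertex nearest to [y], on shortest paths from [a] to [y], that is close to this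
    forest. One strand starts from [b], and another leads from [y] towards [b]. *)
Lemma pair_stage x y : x \in X -> y \in X ->
  exists st, [/\ valid st, extends start st, owned st x, owned st y &
  forall T, admissible st T ->
  [/\ wk w T x y (dX x y + 76 * sg),
      forall g, g \in cov st -> dX g x <= 6 * sg -> wk w T g x (100 * sg),
      forall g, g \in cov st -> dX g y <= 6 * sg -> wk w T g y (121 * sg) &
      forall g, g \in cov st -> exists2 s, s \in S & wk w T g s (24 * rho)]].
Proof.
move=> xX yX; have [st2 [a hs]] := half_stageP xX yX.
have sg0 := sg_ge0; have sgr := sg_rho.
have v2 := hs_valid hs; have aX := hs_aX hs; have xay := hs_between hs.
have inX g : g \in cov st2 -> g \in X by apply: covX.
have cl2 v : v \in X -> owned st2 v -> exists2 f, f \in cov st2 & dX v f <= sg.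
  move=> vX /ownedP[f fC uf]; exists f => //.
  have /(un_diam vX) : f \in un v by rewrite -uf un_refl //; apply: inX.
  by have := rad_sg vX; have := rad_ge0 v; lra.
pose close p := [&& p \in X, dX a p + dX p y == dX a y &
  [exists f in cov st2, dX p f <= 6 * sg]].
have closeP p f : p \in X -> f \in cov st2 -> dX a p + dX p y = dX a y ->
    dX p f <= 6 * sg -> close p.
  by move=> pX fC E d; rewrite /close pX E eqxx; apply/exists_inP; exists f.
have ca : close a.
  have [f fC d] := cl2 a aX (hs_a hs); apply: closeP fC _ _ => //; last by lra.
  by rewrite dxx add0r.
case: (@arg_minP _ R _ a close (fun p => dX p y) ca) => b.
case/and3P=> bX /eqP aby /exists_inP[f0 f0C df0] bmin.
have xab : dX x a + dX a b = dX x b.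
  by have := tri a x b; have := tri b x y; lra.
have xby : dX x b + dX b y = dX x y by lra.
have [e eC emin] := nearestP b f0C.
have be : dX b e <= 6 * sg by apply: le_trans (emin _ f0C) df0.
have [st3 [v3 x3 o3 l3]] := lay v2 bX (inX _ eC) (cov_owned eC).
have [st4 [v4 x4 o4 l4]] := lay v3 yX bX o3.
have new3 T f : admissible st3 T -> f \in cov st3 -> f \notin cov st2 ->
    cl T f b (6 * sg).
  move=> aT fC fN; move: l3; case: ifPn => [_ E|ob [p [_ _ bC h]]].
    by rewrite E (negPf fN) in fC.
  have [lf E _ _] := h f fC fN; have d : dX f b <= 6 * sg.
    by have := ge0 f e; rewrite (sym f b); lra.
  split=> //; apply: wk_le d _; apply: (val_iso v3 aT) => //.
  by have [-> *] := h b bC (contra (@cov_owned st2 b) ob).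
have b_near T : admissible st3 T -> exists2 f, f \in cov st2 & cl T b f (7 * sg).
  move=> aT; have aT2 := adm_ext x3 aT.
  move: l3; case: ifPn => [ob _|ob [p [pX op bC h]]].
    have [f [fC _ c]] := hop v2 aT2 bX ob; exists f => //; apply: cl_le c; lra.
  have [_ _ E W] := h b bC (contra (@cov_owned st2 b) ob).
  have [f [fC _ c]] := hop v2 aT2 pX op; exists f => //.
  have -> : 7 * sg = 6 * sg + sg by lra.
  apply: cl_trans c; have d : dX b p <= 6 * sg by have := ge0 p e; lra.
  by split=> //; apply: wk_le d (W T aT).
(* By the choice of [b], no other vertex on the way from [y] to [b] is close to the earlier forest.
   So the strand from [y] can only stop at [b] or at a unit owned by the short strand of [b]. *)
have onb q : q \in X -> dX y q + dX q b = dX y b -> forall f, f \in cov st2 ->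
    dX q f <= 6 * sg -> q = b.
  move=> qX yqb f fC d; apply: (ds_eq0 ewX).
  have /bmin : close q.
    apply: closeP fC _ d => //; have := tri q a y; have := tri b a q.
    by rewrite (sym b q) (sym y q) (sym y b) in yqb *; lra.
  by rewrite (sym b y) (sym q y); lra.
have atb T q : admissible st3 T -> q \in X -> owned st3 q ->
    dX y q + dX q b = dX y b -> wk w T q b (7 * sg).
  move=> aT qX oq yqb; have [f [fC uf c]] := hop v3 aT qX oq.
  have [fC2|fN] := boolP (f \in cov st2).
    have -> : q = b by apply: (onb q qX yqb f fC2); have [_] := c; lra.
    by apply: wk_refl; lra.
  have -> : 7 * sg = sg + 6 * sg by lra.
  by apply: wk_trans c.1 _; have [] := new3 T f aT fC fN.
exists st4; split=> //.
- exact: ext_trans (hs_ext hs) (ext_trans x3 x4).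
- exact: owned_ext (ext_trans x3 x4) (hs_x hs).
move=> T aT4; have aT3 := adm_ext x4 aT4; have aT2 := adm_ext x3 aT3.
have ewT := adm_ew aT4.
have [f1 f1C [bf1 dbf1]] := b_near T aT3.
have Wxb : wk w T x b (dX x b + 69 * sg).
  apply: (wk_le (r := dX x b + 62 * sg + 7 * sg)); first by lra.
  apply: wk_trans (wk_sym ewT bf1); by have := hs_far hs aT2 f1C bX aby dbf1.
have new4 g : g \in cov st4 -> g \notin cov st3 ->
    [/\ lab st4 g = Some y, dX y b = dX y g + dX g b,
     y \in cov st4, y \notin cov st3 & wk w T g b (dX g b + 7 * sg)].
  move=> gC gN; move: l4; case: ifPn => [_ E|oy [q [qX oq yC h]]].
    by rewrite E (negPf gN) in gC.
  have [lg E1 E2 W] := h g gC gN; split=> //.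
    by apply: contra oy; apply: cov_owned.
  apply: (wk_le (r := dX g q + 7 * sg)); first by have := ge0 q b; lra.
  apply: wk_trans (W T aT4) _; apply: atb => //.
  by have := tri g y q; have := tri q y b; lra.
have Wyb : wk w T y b (dX y b + 7 * sg).
  have [oy|oy] := boolP (owned st3 y).
    apply: (wk_le (r := 7 * sg)); first by have := ge0 y b; lra.
    by apply: atb => //; rewrite dxx add0r.
  move: l4; rewrite (negPf oy) => -[q [_ _ yC _]].
  have yN : y \notin cov st3 by apply: contra oy; apply: cov_owned.
  by have [] := new4 y yC yN.
split.
- apply: (wk_le (r := dX x b + 69 * sg + (dX y b + 7 * sg))).
    by rewrite (sym y b); lra.
  by apply: wk_trans Wxb _; apply: wk_sym.
- move=> g gC gx; have [gC3|gN] := boolP (g \in cov st3); last first.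
    have [_ E _ _ W] := new4 g gC gN.
    apply: (wk_le (r := dX g b + 7 * sg + (dX x b + 69 * sg))).
      by have := tri g x y; rewrite (sym x g) (sym g y); rewrite (sym b y) in xby; lra.
    by apply: wk_trans W _; apply: wk_sym.
  have [gC2|gN] := boolP (g \in cov st2); first exact: (hs_near_x hs aT2 gC2 gx).
  have [W d] := new3 T g aT3 gC3 gN.
  apply: (wk_le (r := 6 * sg + (dX x b + 69 * sg))).
    by have := tri g x b; rewrite (sym x g); lra.
  by apply: wk_trans W _; apply: wk_sym.
- move=> g gC gy; have [gC3|gN] := boolP (g \in cov st3); last first.
    have [lg _ yC yN _] := new4 g gC gN; have [ly _ _ _ _] := new4 y yC yN.
    by apply: wk_le (val_iso v4 aT4 gC yC _); rewrite ?lg ?ly //; lra.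
  have [gC2|gN] := boolP (g \in cov st2).
    have yb : y = b.
      by apply: (onb y yX _ g gC2); rewrite ?dxx ?add0r // sym.
    rewrite yb; apply: (wk_le (r := 114 * sg + 7 * sg)); first by lra.
    apply: wk_trans (wk_sym ewT bf1); apply: (hs_near_y hs aT2 gC2 f1C).
      by rewrite yb in gy *; lra.
    by rewrite sym yb.
  have [W d] := new3 T g aT3 gC3 gN.
  apply: (wk_le (r := 6 * sg + (dX y b + 7 * sg))).
    by have := tri g y b; rewrite (sym y g); lra.
  by apply: wk_trans W _; apply: wk_sym.
- have h3 g : g \in cov st3 -> exists2 s, s \in S & wk w T g s (18 * rho).
    move=> gC; have [gC2|gN] := boolP (g \in cov st2).
      have [s sS W] := hs_S hs aT2 gC2; exists s => //; apply: wk_le W; lra.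
    move: l3; case: ifPn => [_ E|ob l]; first by rewrite E (negPf gN) in gC.
    have [f fC W] := laid_length v2 x3 v3 bX (inX _ eC) l aT3 gC gN.
    have [s sS W'] := hs_S hs aT2 fC; exists s => //.
    by apply: wk_le (wk_trans W W'); lra.
  move=> g gC; have [gC3|gN] := boolP (g \in cov st3).
    have [s sS W] := h3 g gC3; exists s => //; apply: wk_le W; lra.
  move: l4; case: ifPn => [_ E|oy l]; first by rewrite E (negPf gN) in gC.
  have [f fC W] := laid_length v3 x4 v4 yX bX l aT4 gC gN.
  have [s sS W'] := h3 f fC; exists s => //.
  by apply: wk_le (wk_trans W W'); lra.
Qed.

(** * Attaching the remaining vertices, net by net *)

Let eta0 : 0 <= eta.
Proof. by have := rad_ge0 s0; have := rad_le (subsetP SX _ s0S); lra. Qed.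

Lemma hop_rad st T v : valid st -> admissible st T -> v \in X -> owned st v ->
  exists f, [/\ f \in cov st, un f = un v & cl T v f (32 * rad v)].
Proof.
move=> vs aT vX o; have [f [fC E W]] := adm_hop aT vX o.
exists f; split=> //; split=> //.
have /(un_diam vX) : f \in un v.
  by rewrite -E un_refl //; apply: subsetP (val_X vs) _ fC.
by have := rad_ge0 v; lra.
Qed.

(** Each strand aims at the vertex of [cov st] nearest to its start, so the length followed up to
    the port is gained on the distance still to go. Only the hop from [v] into the strand is lost,
    once in the walk and once in the triangle inequality: [2 * eta] per strand, with no
    multiplicative loss. *)
Lemma net_stage st (zs : seq V) e0 : valid st -> {subset zs <= X} -> e0 \in cov st ->
  exists st', [/\ valid st', extends st st', {in zs, forall z, owned st' z} &
   forall T v g0, admissible st' T -> v \in X -> owned st' v -> g0 \in cov st ->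
     exists2 g, g \in cov st & cl T v g (dX v g0 + (2 * size zs + 1)%:R * eta)].
Proof.
move=> vst; have inX g : g \in cov st -> g \in X by apply: subsetP (val_X vst) _.
elim: zs => [|z zs IH] zsX e0C.
  exists st; split=> //.
  move=> T v g0 aT vX o gC; have [f [fC _ c]] := hop_rad vst aT vX o.
  exists f => //; apply: cl_le c.
  by have := rad_le vX; have := ge0 v g0; rewrite muln0 add0n; lra.
have [|//|st1 [v1 x1 o1 h1]] := IH; first by move=> v vz; apply: zsX; rewrite inE vz orbT.
have zX : z \in X by apply: zsX; rewrite inE eqxx.
have [e eC emin] : exists2 e, e \in cov st & forall g, g \in cov st -> dX z e <= dX z g.
  exact: nearestP e0C.
have [st2 [v2 x2 o2 l2]] := lay v1 zX (inX _ eC) (cov_owned (ext_in x1 eC)).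
exists st2; split=> //.
- exact: ext_trans x1 x2.
- move=> v; rewrite inE => /orP[/eqP ->//|vz].
  by apply: owned_ext x2 _; apply: o1.
have -> : (2 * size (z :: zs) + 1)%:R = (2 * size zs + 1)%:R + 2 :> R.
  by rewrite -natrD; congr (_%:R); rewrite /=; lia.
move=> T v g0 aT vX ov g0C; have aT1 := adm_ext x2 aT.
have [ov1|nv1] := boolP (owned st1 v).
  have [g gC c] := h1 T v g0 aT1 vX ov1 g0C; exists g => //; apply: cl_le c.
  by have := eta0; lra.
have [f [fC uf c]] := hop_rad v2 aT vX ov.
have fN : f \notin cov st1.
  by apply: contra nv1 => fC1; apply/ownedP; exists f.
move: l2; case: ifPn => [_ E|oz [a [aX oa zC h]]]; first by rewrite E (negPf fN) in fC.
have [_ E1 E2 W] := h f fC fN.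
have [g gC c2] := h1 T a e aT1 aX oa eC; exists g => //.
apply: (cl_le (r := 32 * rad v + dX f a + (dX a e + (2 * size zs + 1)%:R * eta))).
  have := emin _ g0C; have := tri f z g0; have := tri v f g0.
  have := rad_le vX; have [_ d] := c; have := sym f v; lra.
apply: cl_trans c2; apply: cl_trans c _; split=> //; exact: W.
Qed.

(* A unit that is not yet owned lies between net points at scale [r], so it is
   small. Strands laid from points of the same colour are too far apart to meet,
   so the way from a vertex to [cov st0] follows at most one strand per colour. *)
Lemma phase st0 st r (N N' : {set V}) (col : V -> nat) (K : nat) A :
  0 <= r -> 0 <= A -> valid st -> cov st0 \subset cov st -> N \subset X -> N' \subset X ->
  {in N, forall z, owned st z} ->
  {in X, forall v, exists2 z, z \in N & dX v z <= 2 * r} ->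
  (forall v, v \in X -> exists2 c, c \in un v &
      forall q, q \in X -> dX c q <= rad v -> q \in un v) ->
  (forall v c, v \in X -> c \in un v -> c \in X) ->
  {in N', forall z, (col z < K)%N} ->
  {in N' &, forall z z', z != z' -> dX z z' <= 14 * r -> col z != col z'} ->
  (forall T v, admissible st T -> v \in X -> owned st v ->
     exists2 g, g \in cov st0 & cl T v g A) ->
  exists st', [/\ valid st', extends st st', {in N', forall z, owned st' z} &
   forall T v, admissible st' T -> v \in X -> owned st' v ->
     exists2 g, g \in cov st0 & cl T v g (A + K%:R * (66 * r))].
Proof.
move=> r0 A0 vst s0C NX NX' oN cN ball unX colK colN bA.
have small v : v \in X -> ~~ owned st v -> rad v <= 2 * r.
  move=> vX nv; rewrite leNgt; apply/negP => rv.
  have [c cu cb] := ball v vX; have [z zN d] := cN c (unX v c vX cu).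
  have zX := subsetP NX _ zN.
  have zu : z \in un v by apply: cb => //; apply: le_trans d (ltW rv).
  by case/negP: nv; apply: owned_un (oN z zN); apply: un_eq.
(* [c] is the last colour treated. A newly owned [v] lies within [2 * r] of [z] along the strand
   plus [10 * r] across its small unit, whence [12 * r]. *)
pose fine st1 c := [/\ valid st1, extends st st1 & forall v, v \in X ->
   owned st1 v -> owned st v \/ exists z, [/\ z \in N', (col z <= c)%N,
     owned st1 z, dX z v <= 12 * r & forall T, admissible st1 T ->
     exists2 g, g \in cov st0 & cl T v g (A + (col z).+1%:R * (66 * r))]].
have step zs st1 c : {subset zs <= N'} -> path leq c (map col zs) -> fine st1 c ->
    exists st2 c2, [/\ extends st1 st2, {in zs, forall z, owned st2 z} & fine st2 c2].
  elim: zs st1 c => [|z zs IH] st1 c zsN' /=.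
    by move=> _ F; exists st1, c; split.
  case/andP=> cz pz [v1 x1 F1].
  have zN : z \in N' by apply: zsN'; rewrite inE eqxx.
  have zX := subsetP NX' _ zN.
  have zsN : {subset zs <= N'} by move=> y yz; apply: zsN'; rewrite inE yz orbT.
  suff [st2 [x2 o2 F2]] : exists st2, [/\ extends st1 st2, owned st2 z & fine st2 (col z)].
    have [st3 [c3 [x3 o3 F3]]] := IH _ _ zsN pz F2.
    exists st3, c3; split=> //; first exact: ext_trans x2 x3.
    move=> y; rewrite inE => /orP[/eqP ->|/o3//]; exact: owned_ext x3 o2.
  have [oz|nz] := boolP (owned st1 z).
    exists st1; split=> //.
    split=> // v vX /(F1 v vX)[?|[z' [? cz' ? ? ?]]]; [by left|right].
    by exists z'; split=> //; apply: leq_trans cz' cz.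
  have [e eN de] := cN z zX; have eX := subsetP NX _ eN.
  have [st2 [v2 x2 o2]] := lay v1 zX eX (owned_ext x1 (oN e eN)).
  rewrite (negPf nz) => -[a [aX oa zC h]].
  exists st2; split=> //; split=> //; first exact: ext_trans x1 x2.
  have za : dX z a <= 2 * r.
    have [|_ E1 E2 _] := h z zC; first by apply: contra nz; apply: cov_owned.
    by have := ge0 a e; lra.
  have ba T : admissible st2 T ->
      exists2 g, g \in cov st0 & cl T a g (A + (col z)%:R * (66 * r)).
    move=> aT; have aT1 := adm_ext x2 aT.
    have [oa0|[z' [zN' cz' oz' da b]]] := F1 a aX oa.
      have [g gC c1] := bA T a (adm_ext x1 aT1) aX oa0; exists g => //; apply: cl_le c1.
      by rewrite lerDl; apply: mulr_ge0; [exact: ler0n|lra].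
    have [g gC c1] := b T aT1; exists g => //; apply: cl_le c1.
    rewrite lerD2l ler_wpM2r ?ler_nat //; first by rewrite mulr_ge0 //; lra.
    (* The colours of [z'] and [z] differ, because these net points are at distance at most
       [12 * r + 2 * r]; so the number of strands on the way is bounded by the colour. *)
    rewrite ltn_neqAle (leq_trans cz' cz) andbT.
    apply: colN => //; last by have := tri a z' z; rewrite (sym a z); lra.
    by apply: contraNneq nz => <-.
  move=> v vX ov; have [ov1|nv1] := boolP (owned st1 v).
    have [?|[z' [? cz' oz' ? b]]] := F1 v vX ov1; [by left|right].
    exists z'; split=> //; first exact: leq_trans cz' cz.
      exact: owned_ext x2 oz'.
    by move=> T /(adm_ext x2)/b.
  right; exists z; split=> //.
    have /ownedP[f fC uf] := ov.
    have fN : f \notin cov st1 by apply: contra nv1 => fC1; apply/ownedP; exists f.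
    have [_ E1 E2 _] := h f fC fN.
    have nv : ~~ owned st v by apply: contra nv1; apply: owned_ext.
    have fv : f \in un v by rewrite -uf un_refl //; apply: subsetP (val_X v2) _ fC.
    have := un_diam vX fv; have := small v vX nv; rewrite (sym v f).
    by have := ge0 f e; have := tri f z v; lra.
  move=> T aT; have [f [fC uf c1]] := hop_rad v2 aT vX ov.
  have fN : f \notin cov st1 by apply: contra nv1 => fC1; apply/ownedP; exists f.
  have [_ E1 E2 W] := h f fC fN.
  have nv : ~~ owned st v by apply: contra nv1; apply: owned_ext.
  have rv := small v vX nv.
  have [g gC c2] := ba T aT; exists g => //.
  (* The hop costs at most [64 * r] as [rad v <= 2 * r], and the strand at most [2 * r]: this is the
     constant 66. *)
  apply: (cl_le (r := 32 * rad v + dX f a + (A + (col z)%:R * (66 * r)))).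
    rewrite -natr1 mulrDl mul1r.
    by have := ge0 a e; have := ge0 z f; lra.
  by apply: cl_trans c2; apply: cl_trans c1 _; split=> //; apply: W.
pose zs := sort (relpre col leq) (enum N').
have zsE : zs =i N' by move=> z; rewrite mem_sort mem_enum.
have [|||st2 [c2 [x2 o2 [v2 x2' F2]]]] := step zs st 0%N.
- by move=> z; rewrite zsE.
- rewrite path_min_sorted; last by apply/allP.
  rewrite sorted_map; apply: sort_sorted => a b; exact: leq_total.
- split=> //.
  by move=> v vX; left.
exists st2; split=> //; first by move=> z zN; apply: o2; rewrite zsE.
move=> T v aT vX ov; have [ov1|[z [zN _ _ _ b]]] := F2 v vX ov.
  have [g gC c1] := bA T v (adm_ext x2 aT) vX ov1; exists g => //; apply: cl_le c1.
  by rewrite lerDl; apply: mulr_ge0; [exact: ler0n|lra].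
have [g gC c1] := b T aT; exists g => //; apply: cl_le c1.
by rewrite lerD2l ler_wpM2r ?ler_nat ?colK //; rewrite mulr_ge0 //; lra.
Qed.

Hypothesis un_X : forall v c, v \in X -> c \in un v -> c \in X.
Hypothesis un_ball : forall v, v \in X -> exists2 c, c \in un v &
  forall q, q \in X -> dX c q <= rad v -> q \in un v.
Variables (s1 : R) (K M : nat).
Hypothesis s1_gt0 : 0 < s1.
Hypothesis s1_sg : s1 <= sg.
Hypothesis packK : forall (r : R) (A : {set V}) (p : V), 0 < r -> r <= s1 ->
  A \subset X -> {in A &, forall z z', z != z' -> r < dX z z'} -> p \in X ->
  {in A, forall z, dX p z <= 14 * r} -> (#|A| <= K)%N.
Hypothesis packM : forall A : {set V}, A \subset X ->
  {in A &, forall z z', z != z' -> s1 < dX z z'} -> (#|A| <= M)%N.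
Hypothesis etaM : (2 * M + 1)%:R * eta <= sg.
Hypothesis s1K : eta + 66 * K%:R * s1 <= sg.

(** The net radius is halved at each phase, so the costs form a geometric series that stays below
    [66 * K * s1]. *)
Lemma phases stB (N0 : {set V}) n : valid stB -> N0 \subset X ->
  {in N0, forall z, owned stB z} ->
  {in X, forall v, exists2 z, z \in N0 & dX v z <= s1} ->
  exists st (N : {set V}), [/\ valid st, extends stB st,
    N \subset X /\ {in N, forall z, owned st z},
    {in X, forall v, exists2 z, z \in N & dX v z <= s1 / 2 ^+ n} &
    forall T v, admissible st T -> v \in X -> owned st v ->
     exists2 g, g \in cov stB & cl T v g (eta + 66 * K%:R * (s1 - s1 / 2 ^+ n))].
Proof.
move=> vB N0X oN0 cN0; elim: n => [|n [st [N [vs xs [NX oN] cN b]]]].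
  exists stB, N0; split=> //; first by rewrite expr0 divr1.
  move=> T v aT vX ov.
  have [f [fC _ c]] := hop_rad vB aT vX ov.
  exists f => //; apply: cl_le c; rewrite expr0 divr1 subrr mulr0 addr0.
  exact: rad_le.
set r := s1 / 2 ^+ n.+1.
have r2 : s1 / 2 ^+ n = 2 * r.
  by rewrite /r exprS invfM mulrCA mulVKf ?pnatr_eq0.
have r0 : 0 < r by rewrite divr_gt0 // exprn_gt0.
have rs1 : r <= s1.
  by rewrite ler_pdivrMr ?exprn_gt0 // ler_peMr ?(ltW s1_gt0) // exprn_ege1 // ler1n.
have [N' [N'X N's N'c]] := net_exists X dxx sym (ltW r0).
have [|||col [colK colN]] := @coloring V (fun u v => dX u v <= 14 * r) N' K.
- by move=> u v; rewrite sym.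
- by move=> v _; rewrite dxx; lra.
- move=> v vN; apply: (packK r0 rs1 (p := v)).
  + by apply/subsetP => u /setIdP[uN _]; apply: subsetP N'X _ uN.
  + by move=> z z' /setIdP[zN _] /setIdP[zN' _]; apply: N's.
  + exact: subsetP N'X _ vN.
  + by move=> z /setIdP[].
rewrite r2 in cN b.
have A0 : 0 <= eta + 66 * K%:R * (s1 - 2 * r).
  rewrite addr_ge0 // mulr_ge0 ?mulr_ge0 // subr_ge0 -r2.
  by rewrite ler_pdivrMr ?exprn_gt0 // ler_peMr ?(ltW s1_gt0) // exprn_ege1 // ler1n.
have [st' [v' x' o' b']] :=
  phase (ltW r0) A0 vs (ext_cov xs) NX N'X oN cN un_ball un_X colK colN b.
exists st', N'; split=> //; first exact: ext_trans xs x'.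
move=> T v aT vX ov; have [g gC c] := b' T v aT vX ov; exists g => //.
by apply: cl_le c; lra.
Qed.

(** The pair is joined first, then an [s1]-net, then finer nets, until the radius drops below the
    least distance and every vertex is a net point. By [etaM] and [s1K] each of the last two stages
    adds an error of at most [sg]. *)
Lemma unit_forest x y : x \in X -> y \in X ->
  exists st, [/\ valid st, {in X, forall v, owned st v} &
  forall T, admissible st T ->
   {in X, forall v, exists2 s, s \in S & wk w T v s (32 * rho)} /\
   {in X &, forall u v, dX u x <= sg -> dX v y <= sg ->
      wk w T u v (dX x y + 307 * sg)}].
Proof.
move=> xX yX.
have [stA [vA xA oxA oyA hA]] := pair_stage xX yX.
have s0A : s0 \in cov stA by apply: subsetP (val_S vA) _ s0S.
have [N0 [N0X N0s N0c]] := net_exists X dxx sym (ltW s1_gt0).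
have [|stB [vB xB oB hB]] := net_stage (zs := enum N0) vA _ s0A.
  by move=> z; rewrite mem_enum; apply: subsetP N0X z.
have [m m0 mP] := min_distance (@ds_gt0 _ _ _ _ ewX).
have [n nm] := halving_lt s1 m0.
have [|st [N [vs xs [NX oN] cN b]]] := phases n vB N0X _ N0c.
  by move=> z zN; apply: oB; rewrite mem_enum.
have oall v : v \in X -> owned st v.
  move=> vX; have [z zN d] := cN v vX.
  suff -> : v = z by apply: oN.
  by apply/eqP; apply: contraTT d => /mP h; rewrite -ltNge; apply: lt_le_trans nm h.
exists st; split=> //.
move=> T aT; have aB := adm_ext xs aT; have aA := adm_ext xB aB.
have ewT := adm_ew aT.
have toB v : v \in X -> exists2 g, g \in cov stB & cl T v g sg.
  move=> vX; have [g gC c] := b T v aT vX (oall v vX); exists g => //.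
  apply: cl_le c; apply: le_trans s1K; rewrite lerD2l ler_wpM2l ?mulr_ge0 //.
  by rewrite gerBl divr_ge0 ?exprn_ge0 // ltW.
have sB : (2 * size (enum N0) + 1)%:R * eta <= sg.
  apply: le_trans etaM; rewrite ler_wpM2r // ler_nat -cardE.
  by rewrite leq_add2r leq_mul2l packM.
have toA g g0 : g \in cov stB -> g0 \in cov stA ->
    exists2 a, a \in cov stA & cl T g a (dX g g0 + sg).
  move=> gC g0C; have gX := subsetP (val_X vB) _ gC.
  have [a aC c] := hB T g g0 aB gX (cov_owned gC) g0C; exists a => //.
  by apply: cl_le c; rewrite lerD2l.
have [pxy px py pS] := hA T aA.
have s0X := subsetP SX _ s0S.
split=> [v vX|].
  have [g gC c] := toB v vX; have gX := subsetP (val_X vB) _ gC.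
  have [a aC c2] := toA g s0 gC s0A; have [s sS W] := pS a aC; exists s => //.
  apply: (wk_le (r := sg + (dX g s0 + sg) + 24 * rho)).
    by have := diamX gX s0X; have := sg_rho; have := eta_sg; have := eta0; lra.
  by apply: wk_trans W; apply: wk_trans c2.1; have [] := c.
have near z u : z \in X -> owned stA z -> u \in X -> dX u z <= sg ->
    exists2 a, a \in cov stA & cl T u a (5 * sg) /\ dX a z <= 6 * sg.
  move=> zX oz uX uz; have [g gC c] := toB u uX.
  have [z' [z'C _ cz]] := hop vA aA zX oz.
  have [a aC c2] := toA g z' gC z'C; exists a => //.
  have c3 : cl T u a (5 * sg).
    apply: (cl_le (r := sg + (dX g z' + sg))).
      have [_ d1] := c; have [_ d2] := cz.
      by have := tri u g z'; have := tri z u z'; rewrite (sym g u); lra.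
    exact: cl_trans c c2.
  split=> //; have [_ d] := c3; have := tri u a z; rewrite (sym a u); lra.
move=> u v uX vX ux vy.
have [a aC [[Wa _] da]] := near x u xX oxA uX ux.
have [b' bC [[Wb _] db]] := near y v yX oyA vX vy.
(* From [u] to the forest, to [x], to [y], and back out to [v]: 5 + 100 + 76 + 121 + 5 = 307. *)
apply: (wk_le (r := 5 * sg + 100 * sg + (dX x y + 76 * sg) + (121 * sg + 5 * sg))).
  lra.
apply: wk_trans (wk_trans (wk_sym ewT (py b' bC db)) (wk_sym ewT Wb)).
by apply: wk_trans pxy; apply: wk_trans Wa (px a aC da).
Qed.

End Skeleton.

(** * Good clusters *)

Section Clusters.
Variables (R : realType) (V : finType) (w : V -> V -> R) (G : graph V).
Hypothesis ewG : edge_weight G w.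
Hypothesis conG : connected_graph G.
Local Notation dG := (ds w G).
Local Notation "'d_[' X ]" := (ds w (induced_graph G X)) (format "'d_[' X ]").

Lemma ew_induced X : edge_weight (induced_graph G X) w.
Proof. by apply: edge_weight_sub ewG; apply: induced_sub. Qed.

Lemma induced_mono (X Y : {set V}) : X \subset Y ->
  subrel (adj (induced_graph G X)) (adj (induced_graph G Y)).
Proof.
by move=> /subsetP XY u v /and3P[/XY uY /XY vY a]; apply/and3P; split.
Qed.

(* A cluster need not contain large balls around each of its vertices, but
   [good_thick] provides one nearby: packing bounds for [dG] thus carry over to
   the metric [d_[X]]. *)
Record good (X : {set V}) (rho : R) : Prop := Good {
  good_con : {in X &, forall u v, connect (adj (induced_graph G X)) u v};
  good_ball : exists2 c, c \in X & forall q, dG c q <= rho -> q \in X;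
  good_diam : {in X &, forall u v, d_[X] u v <= 5 * rho};
  good_thick : forall s, 0 < s -> s <= rho -> forall v, v \in X ->
    exists v', [/\ v' \in X, d_[X] v v' <= 9 * s &
      forall q, dG v' q <= s -> q \in X] }.

Lemma dG_le_dX (X : {set V}) u v :
  connect (adj (induced_graph G X)) u v -> dG u v <= d_[X] u v.
Proof. by apply: ds_sub => //; apply: induced_sub. Qed.

Lemma dX_mono (X Y : {set V}) u v : X \subset Y ->
  connect (adj (induced_graph G X)) u v -> d_[Y] u v <= d_[X] u v.
Proof.
by move=> XY; apply: ds_sub; [apply: ew_induced|apply: induced_mono].
Qed.

(* A shortest path from [v] of length at most [s] stays in the [s]-ball of [v]. *)
Lemma wk_ball (X : {set V}) v q s : (forall x, dG v x <= s -> x \in X) ->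
  dG v q <= s -> wk w (induced_graph G X) v q (dG v q).
Proof.
move=> ball vq; have [p [P L W]] := ds_wk ewG (conG v q).
have gen p' : forall u, path (adj G) u p' -> u \in X ->
    dG v u + walk_weight w u p' <= s -> path (adj (induced_graph G X)) u p'.
  elim: p' => [|x p' IH] u //= /andP[a P'] uX.
  rewrite walk_weight_cons => h; have xp := walk_weight_ge0 ewG P'.
  have ux : dG v x <= dG v u + w u x.
    apply: le_trans (ds_tri ewG u v x) _; rewrite lerD2l.
    by apply: ds_le => //; apply: wk_edge.
  have xX : x \in X by apply: ball; lra.
  by rewrite /induced_adj uX xX a /=; apply: IH => //; lra.
exists p; split=> //; apply: gen => //; rewrite ?ds_refl //; last by lra.
by apply: ball; rewrite ds_refl //; apply: le_trans (ds_ge0 ewG v q) vq.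
Qed.

Lemma dX_ball (X : {set V}) v q s : (forall x, dG v x <= s -> x \in X) ->
  dG v q <= s -> d_[X] v q <= dG v q.
Proof. by move=> b h; apply: ds_le; [apply: ew_induced|apply: wk_ball b h]. Qed.

(** * Packing bounds from the doubling property *)

Section Packing.
Variable n : nat.
Hypothesis doubling : forall x r, 0 < r -> exists C : {set V}, (#|C| <= n)%N /\
  forall y, dG x y <= r -> exists2 c, c \in C & dG c y <= r / 2.

Lemma ball_cover k x r : 0 < r -> exists C : {set V}, (#|C| <= n ^ k)%N /\
  forall y, dG x y <= r -> exists2 c, c \in C & dG c y <= r / 2 ^+ k.
Proof.
move=> r0; elim: k => [|k [C [Cn Cc]]].
  exists [set x]; split; first by rewrite cards1.
  by move=> y xy; exists x; rewrite ?inE // expr0 divr1.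
have rk : 0 < r / 2 ^+ k by rewrite divr_gt0 // exprn_gt0.
have /choice[F FP] c := doubling c rk.
exists (\bigcup_(c in C) F c); split.
  have : (#|\bigcup_(c in C) F c| <= \sum_(c in C) #|F c|)%N.
    elim/big_rec2: _ => [|c m D _ h]; first by rewrite cards0.
    by apply: leq_trans (leq_card_setU _ _) _; rewrite leq_add2l.
  move=> h; apply: leq_trans h _; apply: leq_trans (_ : \sum_(c in C) n <= _)%N.
    by apply: leq_sum => c _; have [] := FP c.
  by rewrite sum_nat_const expnSr leq_mul2r Cn orbT.
move=> y /Cc[c cC cy]; have [_ /(_ y cy)[c' c'F c'y]] := FP c.
exists c'; first by apply/bigcupP; exists c.
by rewrite exprSr invfM mulrA.
Qed.

(** Balls of radius [s / 2] cover [A], and each contains at most one of its points. *)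
Lemma packing k (A : {set V}) p s : 0 < s ->
  {in A &, forall a b, a != b -> s < dG a b} ->
  {in A, forall a, dG p a <= 2 ^+ k * s} -> (#|A| <= n ^ k.+1)%N.
Proof.
move=> s0 As Ap; have r0 : 0 < 2 ^+ k * s by rewrite mulr_gt0 // exprn_gt0.
have [C [Cn Cc]] := ball_cover k.+1 p r0.
have half : 2 ^+ k * s / 2 ^+ k.+1 = s / 2.
  by rewrite exprS; field; rewrite expf_neq0.
have /choice[f fP] a : exists c, a \in A -> c \in C /\ dG c a <= s / 2.
  have [aA|_] := boolP (a \in A); last by exists a.
  by have [c cC ca] := Cc a (Ap a aA); exists c; rewrite -half.
apply: leq_trans Cn; rewrite -(@card_in_imset _ _ f (mem A)).
  by apply: subset_leq_card; apply/subsetP => _ /imsetP[a aA ->]; have [] := fP a aA.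
move=> a b aA bA E; apply/eqP; apply: contraT => ab.
have := As a b aA bA ab; have [_ fa] := fP a aA; have [_ fb] := fP b bA.
by rewrite -E in fb; have := ds_tri ewG (f a) a b; rewrite (ds_sym ewG a (f a)); lra.
Qed.

(** By [good_thick] at scale [s / 36], each point moves by at most [s / 4] to one whose ball of
    radius [s / 36] lies in [X]. There [dG] and [d_[X]] agree, so the moved points stay [s / 36]
    apart for [dG] and [packing] applies. *)
Lemma packing_good (X : {set V}) rho k (A : {set V}) p s :
  good X rho -> A \subset X -> p \in X -> 0 < s -> s <= 36 * rho ->
  {in A &, forall a b, a != b -> s < d_[X] a b} ->
  {in A, forall a, d_[X] p a <= (2 ^+ k / 36 - 1 / 4) * s} -> (#|A| <= n ^ k.+1)%N.
Proof.
move=> gX AX pX s0 sr As Ap; have ewX := @ew_induced X.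
have s36 : 0 < s / 36 by lra.
have /choice[f fP] a : exists a', a \in A -> [/\ a' \in X, d_[X] a a' <= s / 4 &
    forall q, dG a' q <= s / 36 -> q \in X].
  have [aA|_] := boolP (a \in A); last by exists a.
  have [|a' [a'X d b]] := good_thick gX s36 _ (subsetP AX _ aA); first by lra.
  by exists a'; split=> //; lra.
have sep a b : a \in A -> b \in A -> a != b -> s / 36 < dG (f a) (f b).
  move=> aA bA ab; rewrite ltNge; apply/negP => h.
  have [faX da ba] := fP a aA; have [fbX db _] := fP b bA.
  have := dX_ball ba h; have := As a b aA bA ab.
  have := ds_tri ewX (f a) a b; have := ds_tri ewX (f b) (f a) b.
  by rewrite (ds_sym ewX (f b) b); lra.
rewrite -(@card_in_imset _ _ f (mem A)); last first.
  move=> a b aA bA E; apply/eqP; apply: contraT => ab.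
  by have := sep a b aA bA ab; rewrite E ds_refl //; lra.
apply: (packing (p := p) (s := s / 36)) => //.
  move=> _ _ /imsetP[a aA ->] /imsetP[b bA ->] h; apply: sep => //.
  by apply: contraNneq h => ->.
move=> _ /imsetP[a aA ->]; have [faX da _] := fP a aA.
apply: le_trans (dG_le_dX (good_con gX pX faX)) _.
have := Ap a aA; have := ds_tri ewX a p (f a).
rewrite mulrBl mulrAC -!mulrA; lra.
Qed.

End Packing.

(* The pointers lead every vertex of [X] to [S], whatever pointers are chosen
   elsewhere, and any [T] that contains them and preserves the distances within
   [S] stretches the pairs [H] by at most [1 + eps]. *)
Definition solved (X S : {set V}) (rX eps : R) (H : V -> V -> Prop) : Prop :=
  exists nx : V -> V,
  [/\ forall v, v \in X -> v \notin S -> adj G v (nx v),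
    forall nx', (forall v, v \in X -> v \notin S -> nx' v = nx v) ->
      forall v, v \in X -> exists k, iter k nx' v \in S &
    forall T : graph V, subrel (adj T) (adj G) ->
      (forall v, v \in X -> v \notin S -> adj T v (nx v)) ->
      {in S &, forall s s', wk w T s s' (d_[X] s s')} ->
      {in X, forall v, exists2 s, s \in S & wk w T v s (32 * rX)} /\
      {in X &, forall u v, H u v -> wk w T u v ((1 + eps) * dG u v)}].

Lemma solved_singleton v S eps H : S != finset.set0 -> S \subset [set v] -> 0 <= eps ->
  solved [set v] S 0 eps H.
Proof.
move=> S0 Sv e0; have -> : S = [set v].
  by apply/eqP; rewrite eqEsubset Sv /=; have [s sS] := set0Pn _ S0;
    rewrite sub1set; move: (sS); rewrite (set1P (subsetP Sv _ sS)).
exists id; split.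
- by move=> u ->.
- by move=> nx' _ u uv; exists 0%N.
- move=> T _ _ _; split=> [u uv|u x /set1P -> /set1P -> _].
    by exists u => //; apply: wk_refl; rewrite mulr0.
  by apply: wk_refl; rewrite ds_refl // mulr0.
Qed.

(** * One step of the recursion over clusters *)

Section Glue.
Variables (n : nat) (X : {set V}) (un : V -> {set V}) (rad : V -> R).
Variables (eps eta sg rho s1 : R) (m : nat).
Hypothesis doubling : forall x r, 0 < r -> exists C : {set V}, (#|C| <= n)%N /\
  forall y, dG x y <= r -> exists2 c, c \in C & dG c y <= r / 2.
Hypothesis gX : good X rho.
Hypothesis un_refl : forall v, v \in un v.
Hypothesis un_eq : forall u v, u \in un v -> un u = un v.
Hypothesis un_X : forall v, v \in X -> un v \subset X.
Hypothesis un_good : forall v, good (un v) (rad v).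
Hypothesis rad_eq : forall u v, un u = un v -> rad u = rad v.
Hypothesis rad_ge0 : forall v, 0 <= rad v.
Hypothesis rad_le : {in X, forall v, 32 * rad v <= eta}.
Hypothesis eta_sg : (2 * n ^ (m + 9) + 1)%:R * eta <= sg.
Hypothesis sg_rho : sg <= rho.
Hypothesis s1_gt0 : 0 < s1.
Hypothesis s1_rho : rho <= 2 ^+ m * s1.
Hypothesis s1_sg : s1 <= sg.
Hypothesis s1K : eta + 66 * (n ^ 11)%:R * s1 <= sg.

(** Within a unit, the forest of [unit_forest] has a single label by [val_lab], hence exact
    distances by [val_iso]: its trace on the unit can play the role of [S] in the recursion inside
    that unit. *)
Lemma glue (S : {set V}) (x y : V) (H : V -> V -> Prop) :
  S != finset.set0 -> S \subset X -> x \in X -> y \in X ->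
  (forall u v, H u v -> un u = un v) ->
  (forall v S', v \in X -> S' != finset.set0 -> S' \subset un v ->
     solved (un v) S' (rad v) eps H) ->
  solved X S rho eps (fun u v => H u v \/
    [/\ d_[X] u x <= sg, d_[X] v y <= sg &
       d_[X] x y + 307 * sg <= (1 + eps) * dG u v]).
Proof.
move=> S0 SX xX yX Hun IH; have ewX := @ew_induced X.
have [s0 s0S] := set0Pn _ S0.
have eta0 : 0 <= eta.
  by have := rad_ge0 s0; have := rad_le (subsetP SX _ s0S); lra.
have sgr := sg_rho; have s10 := s1_gt0; have s1s := s1_sg; have s1r := s1_rho.
have unX v c : v \in X -> c \in un v -> c \in X by move=> /un_X/subsetP; apply.
have eta_le : eta <= sg.
  by apply: le_trans eta_sg; rewrite natrD mulrDl mul1r lerDr mulr_ge0.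
have rho0 : 0 <= rho by lra.
have [||||st [vst ost hst]] := @unit_forest R V w G ewG X (good_con gX) un rad S
    (fun v _ => un_refl v) (fun u v _ => @un_eq u v) SX eta sg rho eta_le sg_rho
    (good_diam gX) _ rad_ge0 rad_le s0 s0S unX _ s1 (n ^ 11) (n ^ (m + 9))
    s1_gt0 _ _ eta_sg s1K x y xX yX.
- move=> u v vX uv; have gu := un_good v.
  have c := good_con gu (un_refl v) uv.
  apply: le_trans (dX_mono (un_X vX) c) _; exact: (good_diam gu).
- move=> v vX; have [c cu cb] := good_ball (un_good v); exists c => // q qX h.
  apply: cb; apply: le_trans h; apply: dG_le_dX.
  by apply: (good_con gX) => //; apply: unX cu.
(* The exponents come from 2^10 / 36 - 1/4 > 14 for nearby net points, and from 2^8 / 36 - 1/4 > 5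
   for the diameter of [X]. *)
- move=> r A p r0 rs1 AX As pX Ap; apply: (@packing_good n doubling X rho 10 A p r gX) => //.
    by lra.
  move=> a aA; apply: le_trans (Ap a aA) _; rewrite ler_pM2r //.
  by rewrite -(natrX _ 2 10); lra.
- move=> A AX As; have sX := subsetP SX _ s0S.
  rewrite addnS; apply: (@packing_good n doubling X rho (m + 8) A s0 s1 gX) => //.
    by lra.
  move=> a aA; apply: le_trans (good_diam gX sX (subsetP AX _ aA)) _.
  have -> : 2 ^+ (m + 8) = 2 ^+ m * 256 :> R by rewrite exprD -(natrX _ 2 8).
  have : 1 <= 2 ^+ m :> R by rewrite exprn_ege1 // ler1n.
  move: s1r; set M := 2 ^+ m => s1r M1.
  have : s1 <= M * s1 by rewrite ler_peMl // ltW.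
  lra.
(* The choice is made for each unit [Y] and not for each vertex, so that all pointers inside a unit
   come from one solution. *)
have /choice[F FP] Y : exists nx : V -> V, forall v, v \in X -> un v = Y ->
   [/\ forall u, u \in Y -> u \notin cov st -> adj G u (nx u),
    forall nx', (forall u, u \in Y -> u \notin cov st -> nx' u = nx u) ->
      forall u, u \in Y -> exists k, iter k nx' u \in cov st :&: Y &
    forall T : graph V, subrel (adj T) (adj G) ->
      (forall u, u \in Y -> u \notin cov st -> adj T u (nx u)) ->
      {in cov st :&: Y &, forall s s', wk w T s s' (d_[Y] s s')} ->
      {in Y, forall u, exists2 s, s \in cov st :&: Y & wk w T u s (32 * rad v)} /\
      {in Y &, forall u u', H u u' -> wk w T u u' ((1 + eps) * dG u u')}].
  have [[v [vX vY]]|no] := pselect (exists v, v \in X /\ un v = Y); last first.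
    by exists id => v vX vY; case: no; exists v.
  have [||nx [n1 n2 n3]] := IH v (cov st :&: un v) vX.
  - by have /ownedP[f fC uf] := ost v vX; apply/set0Pn; exists f; rewrite inE fC -uf un_refl.
  - exact: subsetIr.
  rewrite vY in n1 n2 n3.
  have N u : u \in Y -> (u \notin cov st :&: Y) = (u \notin cov st).
    by move=> uY; rewrite inE uY andbT.
  exists nx => v' v'X v'Y; have -> : rad v' = rad v by apply: rad_eq; rewrite vY.
  split.
  - by move=> u uY uC; apply: n1; rewrite ?N.
  - by move=> nx' E u uY; apply: n2 => // u' u'Y; rewrite N //; apply: E.
  - move=> T TG Tn TS; apply: n3 => // u uY; rewrite N //; exact: Tn.
pose nxt u := if u \in cov st then nx st u else F (un u) u.
have SC u : u \in S -> u \in cov st by apply: subsetP (val_S vst) u.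
have CX u : u \in cov st -> u \in X by apply: subsetP (val_X vst) u.
have SN u : u \notin cov st -> u \notin S by apply: contra; apply: SC.
have nxtF v u : u \in un v -> u \notin cov st -> nxt u = F (un v) u.
  by move=> uv uC; rewrite /nxt (negPf uC) (un_eq uv).
exists nxt; split.
- move=> v vX vS; have [vC|vC] := boolP (v \in cov st).
    by rewrite /nxt vC; apply: (val_adj vst).
  have [n1 _ _] := FP (un v) v vX erefl.
  by rewrite (nxtF v) //; apply: n1.
- move=> nx' E.
  have unit v : v \in X -> exists k, iter k nx' v \in cov st :&: un v.
    move=> vX; have [_ n2 _] := FP (un v) v vX erefl; apply: n2 => // u uv uC.
    by rewrite E ?(nxtF v) ?SN //; apply: unX uv.
  have lead f : f \in cov st -> exists k, iter k nx' f \in S.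
    apply: (val_lead vst) => [g gC gS|v vX _].
      by rewrite E ?CX // /nxt gC.
    have [k] := unit v vX; rewrite inE => /andP[kC /un_eq kE].
    by exists k; rewrite kC kE eqxx.
  move=> v vX; have [k] := unit v vX; rewrite inE => /andP[kC _].
  by have [k' k'S] := lead _ kC; exists (k' + k)%N; rewrite iterD.
- move=> T TG Tn TS.
  have c : carries w G X S st T.
    split=> // f fC fS; have := Tn f (CX f fC) fS; by rewrite /nxt fC.
  have part v : v \in X ->
     {in un v, forall u, exists2 s, s \in cov st :&: un v & wk w T u s (32 * rad v)} /\
     {in un v &, forall u u', H u u' -> wk w T u u' ((1 + eps) * dG u u')}.
    move=> vX; have [_ _ n3] := FP (un v) v vX erefl; apply: n3 => //.
      move=> u uv uC; rewrite -(nxtF v) //; apply: Tn; [exact: unX uv|exact: SN].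
    move=> f f' /setIP[fC fv] /setIP[f'C f'v].
    apply: wk_le (val_iso vst c fC f'C _).
      apply: dX_mono (un_X vX) _; exact: (good_con (un_good v)).
    by apply: (val_lab vst) => //; rewrite (un_eq fv) (un_eq f'v).
  have a : admissible w G X un rad S st T.
    split=> // v vX _; have [h _] := part v vX; have [s] := h v (un_refl v).
    by case/setIP=> sC sv W; exists s; split=> //; apply: un_eq.
  have [h1 h2] := hst T a; split=> // u v uX vX [Huv|[ux vy le]].
    have [_ h] := part v vX; apply: h => //.
    by rewrite -(Hun u v Huv) un_refl.
  by apply: wk_le le _; apply: h2.
Qed.

End Glue.
End Clusters.

(** * Laminar families of clusters *)

Section Laminar.
Variables (R : realType) (V : finType) (w : V -> V -> R) (G : graph V).
Hypothesis ewG : edge_weight G w.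
Hypothesis conG : connected_graph G.
Local Notation dG := (ds w G).
Local Notation "'d_[' X ]" := (ds w (induced_graph G X)) (format "'d_[' X ]").
Local Notation good := (good w G).

(* [reach c B v b]: [v] can be reached from [c] with a budget [B] of which [b]
   remains, where an edge may be traversed only if the budget covers twice its
   length. So a vertex reached through a long edge keeps a large budget, which
   makes the set of reachable vertices thick. *)
Inductive reach (c : V) (B : R) : V -> R -> Prop :=
| reach0 : reach c B c B
| reachS u v b : reach c B u b -> adj G u v -> 2 * w u v <= b ->
    reach c B v (b - w u v).

Definition thick_ball (c : V) (B : R) : {set V} := [set v | `[< exists b, reach c B v b >]].

Lemma in_thick_ball c B v b : reach c B v b -> v \in thick_ball c B.
Proof. by move=> h; rewrite inE; apply/asboolP; exists b. Qed.

Lemma reach_walk c B u b p : reach c B u b -> path (adj G) u p ->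
  2 * walk_weight w u p <= b -> reach c B (last u p) (b - walk_weight w u p).
Proof.
elim: p u b => [|v p IH] u b r /=; first by rewrite walk_weight_nil subr0.
case/andP=> a P; rewrite walk_weight_cons => h.
have p0 := walk_weight_ge0 ewG P; have [w0 _] := ewG a.
have -> : b - (w u v + walk_weight w v p) = b - w u v - walk_weight w v p by lra.
by apply: IH => //; [apply: reachS => //; lra|lra].
Qed.

Lemma reach_ball c B v b s q : reach c B v b -> 2 * s <= b -> dG v q <= s ->
  q \in thick_ball c B.
Proof.
move=> r sb vq; have [p [P L W]] := ds_wk ewG (conG v q).
by have := reach_walk r P; rewrite L => /(_ _)/in_thick_ball; apply; lra.
Qed.

Lemma reach_wk c B v b : reach c B v b -> 0 <= B ->
  0 <= b /\ wk w (induced_graph G (thick_ball c B)) c v (B - b).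
Proof.
move=> r B0; elim: r => [|u x b' r [b0 W] a h].
  by split=> //; apply: wk_refl; rewrite subrr.
have [w0 _] := ewG a; split; first by lra.
have -> : B - (b' - w u x) = B - b' + w u x by lra.
apply: wk_trans W _; apply: wk_edge; rewrite /= /induced_adj a (in_thick_ball r).
by rewrite (in_thick_ball (reachS r a h)).
Qed.

(** The traversal is followed backwards until the budget is at least [2 * s]. Since an edge at most
    halves the budget, one that brings it below [2 * s] starts from less than [4 * s], which bounds
    the distance gone back. *)
Lemma reach_thick c B v b s : reach c B v b -> 0 < s -> 2 * s <= B ->
  exists v' b', [/\ reach c B v' b', 2 * s <= b' &
    wk w (induced_graph G (thick_ball c B)) v v' (4 * s)].
Proof.
move=> r s0 sB.
suff [h|[v' [b' [r' sb W]]]] : 2 * s <= b \/ exists v' b', [/\ reach c B v' b',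
    2 * s <= b' & wk w (induced_graph G (thick_ball c B)) v v' (4 * s - b)].
- by exists v, b; split=> //; apply: wk_refl; lra.
- exists v', b'; split=> //; apply: wk_le W.
  by have [] := reach_wk r; lra.
elim: r => [|u x b' r IH a h]; first by left.
have [h'|h'] := leP (2 * s) (b' - w u x); [by left|right].
have e : wk w (induced_graph G (thick_ball c B)) x u (w u x).
  have [_ ->] := ewG a; apply: wk_edge.
  by rewrite /= /induced_adj adj_sym a (in_thick_ball r) (in_thick_ball (reachS r a h)).
case: IH => [sb|[v' [b2 [r' sb W]]]].
  by exists u, b'; split=> //; apply: wk_le e; lra.
exists v', b2; split=> //.
have -> : 4 * s - (b' - w u x) = w u x + (4 * s - b') by lra.
exact: wk_trans e W.
Qed.

(** * Clusters as unions of lower units *)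

Section Closure.
Variables (un : V -> {set V}) (rad : V -> R) (rho : R).
Hypothesis rho_gt0 : 0 < rho.
Hypothesis un_refl : forall v, v \in un v.
Hypothesis un_good : forall v, good (un v) (rad v).
Hypothesis rad_le : forall v, 10 * rad v <= rho.

(** The budget [2 * rho] guarantees that the ball of radius [rho] is reached. Units are swallowed
    whole, which keeps the family laminar. *)
Definition closure (c : V) : {set V} := \bigcup_(v in thick_ball c (2 * rho)) un v.

Lemma closure_un c v : v \in thick_ball c (2 * rho) -> un v \subset closure c.
Proof. by move=> vB; apply: bigcup_sup. Qed.

Lemma closure_sub c : thick_ball c (2 * rho) \subset closure c.
Proof. by apply/subsetP => v vB; apply: subsetP (closure_un vB) _ (un_refl v). Qed.

Lemma closure_ball c q : dG c q <= rho -> q \in closure c.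
Proof.
move=> h; apply: (subsetP (closure_sub c) q).
exact: reach_ball (reach0 c (2 * rho)) (lexx _) h.
Qed.

Lemma closure_wk c u : u \in closure c ->
  wk w (induced_graph G (closure c)) c u (5 / 2 * rho).
Proof.
case/bigcupP => v; rewrite inE => /asboolP[b r] uv.
have vB := in_thick_ball r; have g := un_good v.
apply: (wk_le (r := 2 * rho - b + d_[un v] v u)).
  have := good_diam g (un_refl v) uv; have := rad_le v.
  have [|+ _] := reach_wk r; first by have := rho_gt0; lra.
  by lra.
apply: wk_trans.
  have [|_ W] := reach_wk r; first by have := rho_gt0; lra.
  by apply: wk_sub W; apply: induced_mono; apply: closure_sub.
apply: (wk_sub (induced_mono (closure_un vB))).
by apply: ds_wk; [apply: ew_induced ewG _|apply: (good_con g)].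
Qed.

Lemma closure_dG c u : u \in closure c -> dG c u <= 5 / 2 * rho.
Proof. by move=> /closure_wk h; apply: ds_le => //; apply: wk_sub h; apply: induced_sub. Qed.

(** For thickness, a vertex of a unit of radius at least [s] uses the thickness of this unit. In a
    smaller unit, at most [5 * s] leads to a vertex of the thick ball and [4 * s] more to a vertex
    with budget [2 * s], whence the constant 9. *)
Lemma closure_good c : good (closure c) rho.
Proof.
have rho0 := rho_gt0; have ew := ew_induced ewG (X := closure c).
have W u v : u \in closure c -> v \in closure c ->
    wk w (induced_graph G (closure c)) u v (5 * rho).
  move=> /closure_wk hu /closure_wk hv; have -> : 5 * rho = 5 / 2 * rho + 5 / 2 * rho by lra.
  exact: wk_trans (wk_sym ew hu) hv.
split.
- by move=> u v uC vC; apply: wk_connect (W u v uC vC).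
- exists c; last exact: closure_ball.
  by apply: closure_ball; rewrite ds_refl //; apply: ltW.
- by move=> u v uC vC; apply: ds_le => //; apply: W.
- move=> s s0 sr u; case/bigcupP => v vB uv; have g := un_good v.
  have uC : un v \subset closure c := closure_un vB.
  have [sv|sv] := leP s (rad v).
    have [v' [v'u d b]] := good_thick g s0 sv uv.
    exists v'; split=> //; first exact: subsetP uC _ v'u.
      by apply: le_trans d; apply: dX_mono uC _ => //; apply: (good_con g).
    by move=> q /b; apply: (subsetP uC q).
  have := vB; rewrite inE => /asboolP[b r].
  have [|v' [b' [r' sb W']]] := reach_thick r s0; first by lra.
  exists v'; split.
  - by apply: subsetP (closure_sub c) _ (in_thick_ball r').
  - apply: ds_le => //; apply: (wk_le (r := d_[un v] u v + 4 * s)).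
      by have := good_diam g uv (un_refl v); lra.
    apply: wk_trans; last by apply: wk_sub W'; apply: induced_mono; apply: closure_sub.
    apply: (wk_sub (induced_mono uC)); apply: ds_wk; first exact: ew_induced.
    by apply: (good_con g).
  - move=> q vq; apply: (subsetP (closure_sub c) q); exact: reach_ball r' sb vq.
Qed.

End Closure.

Lemma solved_sub (X S : {set V}) rX eps (H H' : V -> V -> Prop) :
  {in X &, forall u v, H u v -> H' u v} ->
  solved w G X S rX eps H' -> solved w G X S rX eps H.
Proof.
move=> HH [nx [n1 n2 n3]]; exists nx; split=> // T TG Tn TS.
have [a b] := n3 T TG Tn TS; split=> // u v uX vX h; apply: b => //.
exact: HH.
Qed.

Lemma good_singleton v : good [set v] 0.
Proof.
have ew := ew_induced ewG (X := [set v]); split.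
- by move=> x y /set1P -> /set1P ->.
- exists v; rewrite ?inE // => q h; rewrite inE eq_sym; apply/eqP; exact: ds_eq0 ewG _ _ h.
- by move=> x y /set1P -> /set1P ->; rewrite ds_refl // mulr0.
- by move=> s s0 s0'; have := lt_le_trans s0 s0'; rewrite ltxx.
Qed.

(** * Induction on the levels of a laminar family *)

Section Levels.
Variables (n m : nat) (eps al be de : R).
Hypothesis doubling : forall x r, 0 < r -> exists C : {set V}, (#|C| <= n)%N /\
  forall y, dG x y <= r -> exists2 c, c \in C & dG c y <= r / 2.
Hypothesis eps0 : 0 <= eps.
Hypothesis al_le : al <= 1 / 4.
Hypothesis de0 : 0 < de.
Hypothesis be0 : 0 < be.
Hypothesis be_al : be <= al.
Hypothesis be_m : 1 <= 2 ^+ m * be.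
Hypothesis de_al : (2 * n ^ (m + 9) + 1)%:R * (32 * de) <= al.
Hypothesis be_K : 32 * de + 66 * (n ^ 11)%:R * be <= al.

Variables (rho : nat -> R) (Z : nat -> {set V}) (fst_pt snd_pt : nat -> V -> V).
Hypothesis rho_gt0 : forall t, 0 < rho t.
Hypothesis rhoS : forall t, de * rho t.+1 = rho t.
Hypothesis Z_sep : forall t, {in Z t &, forall c c', c != c' -> 5 * rho t < dG c c'}.

(* The unit at level [t] of a vertex, with its radius. *)
Fixpoint units t : V -> {set V} * R :=
  if t is t'.+1 then fun v =>
    let cl c := closure (fun x => (units t' x).1) (rho t') c in
    if [pick c in Z t' | v \in cl c] is Some c then (cl c, rho t') else units t' v
  else fun v => ([set v], 0).

Local Notation un t v := (units t v).1.
Local Notation rad t v := (units t v).2.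
Local Notation cl t c := (closure (fun x => un t x) (rho t) c).

Let de_small : de <= 1 / 32.
Proof.
have h : 32 * de <= (2 * n ^ (m + 9) + 1)%:R * (32 * de).
  by rewrite ler_peMl ?ler1n ?addn1 //; have := de0; lra.
by have := de_al; have := al_le; lra.
Qed.

Record units_ok t : Prop := UnitsOk {
  ok_refl : forall v, v \in un t v;
  ok_eq : forall u v, u \in un t v -> units t u = units t v;
  ok_good : forall v, good (un t v) (rad t v);
  ok_ge0 : forall v, 0 <= rad t v;
  ok_rad : forall v, rad t v <= de * rho t }.

Lemma ok_rad10 t v : units_ok t -> 10 * rad t v <= rho t.
Proof.
move=> ok; have := ok_rad ok v; have r := rho_gt0 t.
have : de * rho t <= 1 / 32 * rho t by rewrite ler_pM2r.
by lra.
Qed.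

Lemma cl_block t c u v : units_ok t -> u \in un t v -> v \in cl t c -> u \in cl t c.
Proof.
move=> ok uv /bigcupP[x xB vx]; apply/bigcupP; exists x => //.
by rewrite -(ok_eq ok vx).
Qed.

(** Clusters have radius at most [5 / 2 * rho t] and their centres are more than [5 * rho t]
    apart. *)
Lemma cl_uniq t c c' v : units_ok t -> c \in Z t -> c' \in Z t ->
  v \in cl t c -> v \in cl t c' -> c = c'.
Proof.
move=> ok cZ c'Z vc vc'; apply/eqP; apply: contraT => /(Z_sep cZ c'Z).
have r10 x := ok_rad10 x ok.
have h := closure_dG (rho_gt0 t) (ok_refl ok) (ok_good ok) r10 vc.
have h' := closure_dG (rho_gt0 t) (ok_refl ok) (ok_good ok) r10 vc'.
by have := ds_tri ewG v c c'; rewrite (ds_sym ewG v c'); lra.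
Qed.

Lemma units_in t c v : units_ok t -> c \in Z t -> v \in cl t c ->
  units t.+1 v = (cl t c, rho t).
Proof.
move=> ok cZ vc /=; case: pickP => [c' /andP[c'Z vc']|/(_ c)]; last by rewrite cZ vc.
by rewrite (cl_uniq ok cZ c'Z vc vc').
Qed.

Lemma units_out t v : (forall c, c \in Z t -> v \notin cl t c) ->
  units t.+1 v = units t v.
Proof. by move=> h /=; case: pickP => // c /andP[/h/negPf ->]. Qed.

Lemma units_case t v : (exists2 c, c \in Z t & v \in cl t c) \/
  (forall c, c \in Z t -> v \notin cl t c).
Proof.
case: (pickP (fun c => (c \in Z t) && (v \in cl t c))) => [c /andP[? ?]|no].
  by left; exists c.
by right=> c cZ; have := no c; rewrite cZ /= => ->.
Qed.

Lemma unitsP t : units_ok t.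
Proof.
elim: t => [|t ok].
  split=> [v|u v|v|v|v] //=.
  - by rewrite inE.
  - by move=> /set1P ->.
  - exact: good_singleton.
  - by apply: mulr_ge0; apply: ltW.
have r10 x := ok_rad10 x ok; have r0 := rho_gt0 t.
split.
- move=> v; have [[c cZ vc]|out] := units_case t v; first by rewrite (units_in ok cZ vc).
  by rewrite units_out //; apply: ok_refl.
- move=> u v; have [[c cZ vc]|out] := units_case t v.
    by rewrite (units_in ok cZ vc) => uc; rewrite (units_in ok cZ uc).
  rewrite (units_out out) => uv; rewrite units_out; first exact: ok_eq.
  move=> c cZ; apply: contra (out c cZ) => uc; apply: (cl_block ok _ uc).
  by rewrite (ok_eq ok uv); apply: ok_refl.
- move=> v; have [[c cZ vc]|out] := units_case t v.
    rewrite (units_in ok cZ vc); exact: closure_good r0 (ok_refl ok) (ok_good ok) r10 c.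
  by rewrite units_out //; apply: ok_good.
- move=> v; have [[c cZ vc]|out] := units_case t v.
    by rewrite (units_in ok cZ vc); apply: ltW.
  by rewrite units_out //; apply: ok_ge0.
- move=> v; have [[c cZ vc]|out] := units_case t v.
    by rewrite (units_in ok cZ vc) rhoS.
  rewrite units_out // rhoS; have := ok_rad10 v ok; have := ok_ge0 ok v.
  by lra.
Qed.

(* [fst_pt t c] and [snd_pt t c] are the two points whose distance is preserved in
   the cluster of [c]; 307 is the constant of [unit_forest]. *)
Definition served t u v := exists2 c, c \in Z t &
  [/\ dG c (fst_pt t c) <= 1 / 4 * rho t, dG c (snd_pt t c) <= 1 / 4 * rho t,
      dG (fst_pt t c) u <= al * rho t, dG (snd_pt t c) v <= al * rho t &
      dG (fst_pt t c) (snd_pt t c) + 307 * (al * rho t) <= (1 + eps) * dG u v].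

Fixpoint served_below t u v : Prop :=
  if t is t'.+1 then served_below t' u v \/ served t' u v else False.

Lemma served_cl t c u v :
  dG c (fst_pt t c) <= 1 / 4 * rho t -> dG c (snd_pt t c) <= 1 / 4 * rho t ->
  dG (fst_pt t c) u <= al * rho t -> dG (snd_pt t c) v <= al * rho t ->
  u \in cl t c /\ v \in cl t c.
Proof.
move=> h1 h2 h3 h4; have ok := unitsP t; have r0 := rho_gt0 t.
have a4 : al * rho t <= 1 / 4 * rho t by rewrite ler_pM2r.
split; apply: closure_ball => //; try exact: (ok_refl ok).
  by have := ds_tri ewG (fst_pt t c) c u; lra.
by have := ds_tri ewG (snd_pt t c) c v; lra.
Qed.

Lemma served_un t u v : served_below t u v -> un t u = un t v.
Proof.
elim: t => //= t IH [h|[c cZ [h1 h2 h3 h4 _]]].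
  have ok := unitsP t; have E : units t u = units t v.
    by apply: (ok_eq ok); rewrite -(IH h); apply: ok_refl.
  have [[c cZ uc]|out] := units_case t u.
    have vc : v \in cl t c by apply: (cl_block ok _ uc); rewrite E; apply: ok_refl.
    by have := units_in ok cZ uc; have := units_in ok cZ vc => /= -> ->.
  have out' c : c \in Z t -> v \notin cl t c.
    move=> cZ; apply: contra (out c cZ) => vc; apply: (cl_block ok _ vc).
    by rewrite -E; apply: ok_refl.
  by have := units_out out; have := units_out out' => /= -> ->; rewrite E.
have [uc vc] := served_cl h1 h2 h3 h4; have ok := unitsP t.
by have := units_in ok cZ uc; have := units_in ok cZ vc => /= -> ->.
Qed.

Let al0 : 0 < al.
Proof. exact: lt_le_trans be0 be_al. Qed.

Lemma glue_level t (X S : {set V}) x y : good X (rho t) ->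
  (forall v, v \in X -> un t v \subset X) ->
  S != finset.set0 -> S \subset X -> x \in X -> y \in X ->
  (forall v S', S' != finset.set0 -> S' \subset un t v ->
     solved w G (un t v) S' (rad t v) eps (served_below t)) ->
  solved w G X S (rho t) eps (fun u v => served_below t u v \/
    [/\ d_[X] u x <= al * rho t, d_[X] v y <= al * rho t &
       d_[X] x y + 307 * (al * rho t) <= (1 + eps) * dG u v]).
Proof.
move=> gX unX S0 SX xX yX IH; have ok := unitsP t; have r0 := rho_gt0 t.
apply: (@glue R V w G ewG conG n X (fun v => un t v) (fun v => rad t v) eps
  (32 * de * rho t) (al * rho t) (rho t) (be * rho t) m) => //.
- exact: ok_refl.
- by move=> u v uv; rewrite (ok_eq ok uv).
- exact: ok_good.
- by move=> u v E; rewrite (@ok_eq _ ok u v) // -E; apply: ok_refl.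
- exact: ok_ge0.
- by move=> v _; have := ok_rad ok v; lra.
- by rewrite mulrA ler_pM2r.
- by rewrite ger_pMl //; have := al_le; lra.
- exact: mulr_gt0.
- by rewrite mulrA ler_peMl // ltW.
- by rewrite ler_pM2r.
- by rewrite mulrA -mulrDl ler_pM2r.
- exact: served_un.
- by move=> v S' _; apply: IH.
Qed.

Lemma solved_units t v S : S != finset.set0 -> S \subset un t v ->
  solved w G (un t v) S (rad t v) eps (served_below t).
Proof.
elim: t v S => [|t IH] v S S0 Sv; first exact: solved_singleton.
have ok := unitsP t; have r0 := rho_gt0 t.
have a4 : al * rho t <= 1 / 4 * rho t by rewrite ler_pM2r.
have [[c cZ vc]|out] := units_case t v; last first.
  (* The unit did not grow at this level, and a pair served at this level would put it inside a
     cluster. *)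
  rewrite (units_out out) in Sv *; apply: solved_sub (IH v S S0 Sv) => x y xv yv.
  case=> // -[c cZ [h1 h2 h3 h4 _]]; have [xc _] := served_cl h1 h2 h3 h4.
  have : v \in cl t c by apply: (cl_block ok _ xc); rewrite (ok_eq ok xv); apply: ok_refl.
  by rewrite (negPf (out c cZ)).
rewrite (units_in ok cZ vc) in Sv *; set X := cl t c in Sv *.
have gX : good X (rho t).
  by apply: closure_good => //; [apply: ok_refl|apply: ok_good|move=> x; apply: ok_rad10].
have unX x : x \in X -> un t x \subset X.
  by move=> xX; apply/subsetP => u ux; apply: (cl_block ok ux xX).
have ballX q : dG c q <= rho t -> q \in X.
  by apply: closure_ball; apply: ok_refl.
(* If a designated point is too far from [c], then [c] serves no pair, and [c] taken twice is a
   harmless default. *)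
pose near := (dG c (fst_pt t c) <= 1 / 4 * rho t) && (dG c (snd_pt t c) <= 1 / 4 * rho t).
pose x := if near then fst_pt t c else c; pose y := if near then snd_pt t c else c.
have cx : dG c x <= 1 / 4 * rho t.
  by rewrite /x /near; case: ifP => [/andP[]|_] //; rewrite ds_refl //; lra.
have cy : dG c y <= 1 / 4 * rho t.
  by rewrite /y /near; case: ifP => [/andP[]|_] //; rewrite ds_refl //; lra.
have xX : x \in X by apply: ballX; lra.
have yX : y \in X by apply: ballX; lra.
apply: solved_sub (glue_level gX unX S0 Sv xX yX IH) => u u' uX u'X.
case=> [h|[c' c'Z [h1 h2 h3 h4 h5]]]; [by left|right].
have [uc' _] := served_cl h1 h2 h3 h4.
have E := cl_uniq ok cZ c'Z uX uc'; move: h1 h2 h3 h4 h5; rewrite -E => h1 h2 h3 h4 h5.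
have nr : near by rewrite /near h1 h2.
(* The balls of radius [1 / 2 * rho t] around [x] and [y] lie in [X], so [d_[X]] is at most [dG] for
   the distances involved. *)
have ballx q : dG x q <= 1 / 2 * rho t -> q \in X.
  by move=> h; apply: ballX; have := ds_tri ewG x c q; lra.
have bally q : dG y q <= 1 / 2 * rho t -> q \in X.
  by move=> h; apply: ballX; have := ds_tri ewG y c q; lra.
have ewX := ew_induced ewG (X := X).
have xE : x = fst_pt t c by rewrite /x nr.
have yE : y = snd_pt t c by rewrite /y nr.
rewrite -xE -?yE in h3 h4 h5 *.
split.
- rewrite (ds_sym ewX); apply: (le_trans _ h3); apply: (dX_ball ewG conG ballx); lra.
- rewrite (ds_sym ewX); apply: (le_trans _ h4); apply: (dX_ball ewG conG bally); lra.
- apply: le_trans h5; rewrite lerD2r; apply: (dX_ball ewG conG ballx).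
  by have := ds_tri ewG c x y; rewrite (ds_sym ewG x c); lra.
Qed.

End Levels.
End Laminar.

(** * Trees from pointers *)

Section PointerTree.
Variables (V : finType) (G : graph V) (r : V) (nx : V -> V).
Hypothesis nx_adj : forall v, v != r -> adj G v (nx v).
Hypothesis nx_root : forall v, exists k, iter k nx v = r.

Definition pointer_adj : rel V :=
  fun u v => (u != r) && (nx u == v) || (v != r) && (nx v == u).

Lemma pointer_sym : symmetric pointer_adj.
Proof. by move=> u v; rewrite /pointer_adj orbC. Qed.

Lemma pointer_irr : irreflexive pointer_adj.
Proof.
move=> u; rewrite /pointer_adj orbb; apply/negP => /andP[/nx_adj a /eqP E].
by rewrite E adj_irr in a.
Qed.

Definition pointer_graph : graph V := Graph pointer_sym pointer_irr.

Lemma pointer_sub : subrel (adj pointer_graph) (adj G).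
Proof.
move=> u v /orP[/andP[ur /eqP <-]|/andP[vr /eqP <-]]; first exact: nx_adj.
by rewrite adj_sym nx_adj.
Qed.

Lemma pointer_next v : v != r -> adj pointer_graph v (nx v).
Proof. by move=> vr; rewrite /= /pointer_adj vr eqxx. Qed.

(** Let [h] count the steps to the root. On a cycle of length at least 3, a vertex [x] of maximal
    [h] has two distinct neighbours, but each of them must be [nx x], as a vertex that points to [x]
    is higher. *)
Lemma pointer_tree : is_tree pointer_graph.
Proof.
have toroot v : connect (adj pointer_graph) v r.
  have [k] := nx_root v; elim: k v => [|k IH] v; first by move=> /= ->.
  rewrite iterSr => /IH c; have [->|vr] := eqVneq v r; first exact: connect0.
  by apply: connect_trans c; apply: connect1; apply: pointer_next.
split.
  move=> u v; apply: connect_trans (toroot u) _.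
  by rewrite adj_connect_sym; apply: toroot.
pose P v k := iter k nx v == r.
have exP v : exists k, P v k by have [k] := nx_root v; exists k; apply/eqP.
pose h v := ex_minn (exP v).
have h_next v : v != r -> (h (nx v) < h v)%N.
  move=> vr; rewrite {2}/h; case: ex_minnP => -[|k] Pk _.
    by rewrite /P /= (negPf vr) in Pk.
  rewrite /h; case: ex_minnP => j _ jmin; apply: jmin.
  by rewrite /P -iterSr.
move=> c /andP[cyc unq]; rewrite leqNgt; apply/negP => c3.
have [x0 x0c] : exists x, x \in c by case: c c3 {cyc unq} => // x; exists x; rewrite inE eqxx.
case: (@arg_maxnP _ x0 (mem c) h x0c) => x xc xmax.
have [i c' E] := rot_to xc.
have cyc' : cycle pointer_adj (x :: c') by rewrite -E rot_cycle.
have unq' : uniq (x :: c') by rewrite -E rot_uniq.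
have sz : (1 < size c')%N.
  by have := size_rot i c; rewrite E /= => Es; rewrite -Es in c3.
have up y : y \in x :: c' -> pointer_adj x y -> y = nx x.
  move=> yc /orP[/andP[_ /eqP //]|/andP[yr /eqP yx]].
  have : y \in c by rewrite -(mem_rot i) E.
  by move=> /xmax; have := h_next y yr; rewrite yx ltnNge /= => /negPf ->.
case: c' sz cyc' unq' up {E} => [|y [|z s]] //= _ /andP[xy].
rewrite rcons_path => /andP[yz /andP[_ lx]] /and3P[_ yN _] up.
have lin : last z s \in z :: s by apply: mem_last.
have := up y; rewrite !inE eqxx orbT => /(_ erefl xy) Ey.
have := up (last z s); rewrite 2!(in_cons, inE) lin !orbT pointer_sym => /(_ erefl lx) El.
by move: yN; rewrite Ey -El lin.
Qed.

End PointerTree.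

Section SingleTree.
Variables (R : realType) (V : finType) (w : V -> V -> R) (G : graph V).
Hypothesis ewG : edge_weight G w.
Hypothesis conG : connected_graph G.
Local Notation dG := (ds w G).
Variables (n m : nat) (eps al be de : R).
Hypothesis doubling : forall x r, 0 < r -> exists C : {set V}, (#|C| <= n)%N /\
  forall y, dG x y <= r -> exists2 c, c \in C & dG c y <= r / 2.
Hypothesis eps0 : 0 <= eps.
Hypothesis al_le : al <= 1 / 4.
Hypothesis de0 : 0 < de.
Hypothesis be0 : 0 < be.
Hypothesis be_al : be <= al.
Hypothesis be_m : 1 <= 2 ^+ m * be.
Hypothesis de_al : (2 * n ^ (m + 9) + 1)%:R * (32 * de) <= al.
Hypothesis be_K : 32 * de + 66 * (n ^ 11)%:R * be <= al.
Variables (rho : nat -> R) (Z : nat -> {set V}) (fst_pt snd_pt : nat -> V -> V).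
Hypothesis rho_gt0 : forall t, 0 < rho t.
Hypothesis rhoS : forall t, de * rho t.+1 = rho t.
Hypothesis Z_sep : forall t, {in Z t &, forall c c', c != c' -> 5 * rho t < dG c c'}.

Let set1_neq0 (r : V) : [set r] != finset.set0.
Proof. by apply/set0Pn; exists r; rewrite inE. Qed.

(** The whole vertex set is treated as a top cluster with [S] reduced to [r]: the condition on the
    distances within [S] becomes trivial, and all pointers lead to the root [r]. *)
Lemma spanning_tree_level t (r : V) : (forall u v, dG u v <= 5 * rho t) ->
  exists T : graph V, [/\ subrel (adj T) (adj G), is_tree T &
    forall u v, served_below w G eps al rho Z fst_pt snd_pt t u v ->
      wk w T u v ((1 + eps) * dG u v)].
Proof.
move=> diam; have r0 := rho_gt0 t.
have ewX := ew_induced ewG (X := [set: V]).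
have gV : good w G [set: V] (rho t).
  split.
  - move=> u v _ _; apply: wk_connect.
    by apply: (wk_ball ewG conG (q := v) (s := dG u v)) => // x; rewrite inE.
  - by exists r; rewrite ?inE // => q; rewrite inE.
  - move=> u v _ _; apply: le_trans (diam u v).
    by apply: (dX_ball ewG conG (s := dG u v)) => // x; rewrite inE.
  - move=> s s0 _ v _; exists v; split => [||q _]; rewrite ?inE //.
    by rewrite (ds_refl ewX) mulr_ge0 // ltW.
have [nx [n1 n2 n3]] := glue_level ewG conG doubling al_le de0 be0 be_al be_m de_al
  be_K rho_gt0 rhoS Z_sep gV (fun v _ => subsetT _) (set1_neq0 r) (subsetT _)
  (in_setT r) (in_setT r) (fun v S' => solved_units ewG conG doubling eps0 al_le de0
  be0 be_al be_m de_al be_K fst_pt snd_pt rho_gt0 rhoS Z_sep (t := t) (v := v) (S := S')).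
have nxa v : v != r -> adj G v (nx v) by move=> vr; apply: n1; rewrite inE.
have nxr v : exists k, iter k nx v = r.
  by have [k /set1P kr] := n2 nx (fun _ _ _ => erefl) v (in_setT v); exists k.
exists (pointer_graph nxa); split.
- exact: pointer_sub.
- exact: pointer_tree.
- have [|v _|_ _ /set1P -> /set1P ->|_ h] := n3 (pointer_graph nxa); first exact: pointer_sub.
  + by rewrite inE; apply: pointer_next.
  + by apply: wk_refl; apply: ds_ge0.
  + by move=> u v suv; apply: h; rewrite ?inE //; left.
Qed.

End SingleTree.

(** * Counting the trees *)

Section Cover.
Variables (R : realType) (V : finType) (w : V -> V -> R) (G : graph V).
Hypothesis ewG : edge_weight G w.
Hypothesis conG : connected_graph G.
Local Notation dG := (ds w G).

Lemma scale_exists (a r : R) : 0 < a -> a <= r ->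
  exists j : nat, r <= a * 2 ^+ j /\ a * 2 ^+ j < 2 * r.
Proof.
move=> a0 ar; have ex : exists j, r <= a * 2 ^+ j.
  have [j h] := halving_lt r a0; exists j.
  by rewrite -ler_pdivrMr ?exprn_gt0 // ltW.
exists (ex_minn ex); case: ex_minnP => -[|j] h jmin; split=> //.
  by rewrite expr0; lra.
have : a * 2 ^+ j < r by rewrite ltNge; apply/negP => /jmin; rewrite ltnn.
by rewrite exprS; lra.
Qed.

Lemma diameter_exists : exists D, forall u v, dG u v <= D.
Proof.
exists (\sum_x \sum_y dG x y) => u v.
rewrite (bigD1 u) //= (bigD1 v) //= -addrA lerDl addr_ge0 // sumr_ge0 // => x _;
  rewrite ?sumr_ge0 // => *; exact: ds_ge0.
Qed.

Section FixedDimension.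
Variables (dn A : nat) (eps : R).
Local Notation n := (2 ^ dn)%N.
Hypothesis A_ge : (14 <= A)%N.
Hypothesis doubling : forall x r, 0 < r -> exists C : {set V}, (#|C| <= n)%N /\
  forall y, dG x y <= r -> exists2 c, c \in C & dG c y <= r / 2.
Hypothesis eps_A : 9888 <= eps * 2 ^+ A.

(* [al], [be] and [de] are the precision of the net of preserved points, the scale
   of the first net of [unit_forest] and the ratio of consecutive scales. *)
Let m := (A + 8 + 11 * dn)%N.
Let g := (dn * (m + 9) + 7 + A)%N.
Let al : R := (2 ^+ A)^-1.
Let be : R := (2 ^+ m)^-1.
Let de : R := (2 ^+ g)^-1.

Let pow_gt0 k : 0 < 2 ^+ k :> R.
Proof. exact: exprn_gt0. Qed.

Let pow_ge1 k : 1 <= 2 ^+ k :> R.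
Proof. by apply: exprn_ege1; lra. Qed.

Let inv_le a b : (a <= b)%N -> (2 ^+ b)^-1 <= (2 ^+ a)^-1 :> R.
Proof. by move=> ab; rewrite lef_pV2 ?posrE ?pow_gt0 // ler_weXn2l //; lra. Qed.

Let inv_gt0 k : 0 < (2 ^+ k)^-1 :> R.
Proof. by rewrite invr_gt0. Qed.

Let al_small : al <= 1 / 16.
Proof. by rewrite div1r (_ : 16 = 2 ^+ 4); [apply: inv_le; lia|ring]. Qed.

Let A2 : (2 <= A)%N.
Proof. exact: leq_trans A_ge. Qed.

Let A1E : A.-1 = (A - 2).+1.
Proof. by case: A A2 => [|[|k]] //= _; rewrite !subSS subn0. Qed.

(** The term [dn * (m + 9)] of [g] cancels the power of [n]; what remains is at most
    [al / 2 + al / 4]. *)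
Lemma parameters_de : (2 * n ^ (m + 9) + 1)%:R * (32 * de) <= al.
Proof.
rewrite natrD natrM natrX -natrX -expnM /de /g 2!exprD 2!invfM -/al natrX.
have h := pow_ge1 (dn * (m + 9)); set y := _ ^+ _ in h *.
have yi : y * y^-1 = 1 by rewrite divff //; apply: lt0r_neq0; lra.
have yi0 : 0 < y^-1 by rewrite invr_gt0; lra.
have -> : (2 ^+ 7)^-1 = 1 / 128 :> R by rewrite div1r; congr _^-1; ring.
have a0 : 0 < al := inv_gt0 A.
have -> : (2%:R * y + 1%:R) * (32 * (y^-1 * (1 / 128) * al)) =
  (y * y^-1 / 2 + y^-1 / 4) * al by field; apply: lt0r_neq0; lra.
rewrite yi ger_pMl //.
have : y^-1 <= 1 by rewrite invf_le1 //; lra.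
lra.
Qed.

Lemma parameters_be : 32 * de + 66 * (n ^ 11)%:R * be <= al.
Proof.
have h1 : de <= (2 ^+ (A + 6))^-1 by apply: inv_le; rewrite /g addnC leq_add2r; apply: leq_trans (leq_addl _ 7).
have a0 : 0 < al := inv_gt0 A.
have E6 : (2 ^+ (A + 6))^-1 = al / 64 :> R.
  by rewrite exprD invfM; congr (_ * _^-1); ring.
have E8 : (n ^ 11)%:R * be = al / 256.
  rewrite -expnM natrX mulnC /be /m 2!exprD 2!invfM -/al.
  have h := pow_gt0 (11 * dn); set y := 2 ^+ (11 * dn) in h *.
  have -> : 2 ^+ 8 = 256 :> R by ring.
  by field; apply: lt0r_neq0.
by rewrite -mulrA E8; rewrite E6 in h1; lra.
Qed.

(** The centres form a net of radius [rho / 8], coloured by [packing] since 5 [rho] is at most 2^6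
    [rho / 8]. [pt q c] is the [q]-th point near [c] of a net of radius [al * rho]; there are at
    most [n ^ A.-1] of them because [rho / 4] is 2^(A-2) times [al * rho]. *)
Lemma scale_points (rho : R) : 0 < rho ->
  exists (Z : nat -> {set V}) (pt : nat -> V -> V),
  (forall k, {in Z k &, forall c c', c != c' -> 5 * rho < dG c c'}) /\
  forall u v, dG u v <= rho / 16 -> exists k q q',
    [/\ (k < n ^ 7)%N, (q < n ^ A.-1)%N, (q' < n ^ A.-1)%N &
    exists2 c, c \in Z k &
    [/\ dG c (pt q c) <= 1 / 4 * rho, dG c (pt q' c) <= 1 / 4 * rho,
        dG (pt q c) u <= al * rho & dG (pt q' c) v <= al * rho]].
Proof.
move=> rho0; have r8 : 0 <= rho / 8 by lra.
have a0 : 0 < al := inv_gt0 A.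
have ar0 : 0 < al * rho by apply: mulr_gt0.
have [N [_ Ns Nc]] := net_exists [set: V] (ds_refl ewG) (ds_sym ewG) r8.
have [M [_ Ms Mc]] := net_exists [set: V] (ds_refl ewG) (ds_sym ewG) (ltW ar0).
pose e := [rel u v | dG u v <= 5 * rho].
have [||v vN|col [colK colN]] := @coloring V e N (n ^ 7).
- by move=> u v /=; rewrite (ds_sym ewG).
- by move=> v _ /=; rewrite ds_refl //; lra.
- apply: (packing ewG doubling (p := v) (s := rho / 8)); first by lra.
    by move=> a b; rewrite !inE => /andP[aN _] /andP[bN _]; apply: Ns.
  move=> a; rewrite !inE => /andP[_ /= h]; apply: le_trans h _.
  by rewrite (_ : 2 ^+ 6 = 64); [lra|ring].
pose near c := [set x in M | dG c x <= 1 / 4 * rho].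
pose pt q c := nth c (enum (near c)) q.
exists (fun k => [set c in N | col c == k]), pt; split.
  move=> k c c'; rewrite !inE => /andP[cN /eqP ck] /andP[c'N /eqP c'k] cc'.
  rewrite ltNge; apply/negP => h.
  by have := colN c c' cN c'N cc' h; rewrite ck c'k eqxx.
have ptP c y : dG c y <= 3 / 16 * rho -> exists q, [/\ (q < n ^ A.-1)%N,
    dG c (pt q c) <= 1 / 4 * rho & dG (pt q c) y <= al * rho].
  move=> cy; have [x xM yx] := Mc y (in_setT y).
  have ar16 : al * rho <= 1 / 16 * rho by rewrite ler_pM2r.
  have xc : x \in enum (near c).
    by rewrite mem_enum inE xM; have := ds_tri ewG y c x; lra.
  exists (index x (enum (near c))); rewrite /pt nth_index //; split.
  - apply: leq_trans (_ : #|near c| <= _)%N; first by rewrite cardE index_mem.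
    rewrite A1E.
    apply: (packing ewG doubling (p := c) (s := al * rho)) => //.
      by move=> a b; rewrite !inE => /andP[aM _] /andP[bM _]; apply: Ms.
    move=> a; rewrite inE => /andP[_ h]; apply: le_trans h _.
    rewrite mulrA ler_pM2r // /al.
    have -> : 2 ^+ A = 2 ^+ (A - 2) * 4 :> R.
      by rewrite -{1}(subnK A2) exprD; congr (_ * _); ring.
    have := pow_gt0 (A - 2); set z := _ ^+ _ => z0.
    by rewrite invfM mulrA divff ?lt0r_neq0 //; lra.
  - by move: xc; rewrite mem_enum inE => /andP[].
  - by rewrite (ds_sym ewG).
move=> u v uv; have [c cN uc] := Nc u (in_setT u).
rewrite (ds_sym ewG) in uc.
have [q [q1 q2 q3]] : exists q, [/\ (q < n ^ A.-1)%N,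
    dG c (pt q c) <= 1 / 4 * rho & dG (pt q c) u <= al * rho].
  by apply: ptP; lra.
have [q' [q1' q2' q3']] : exists q, [/\ (q < n ^ A.-1)%N,
    dG c (pt q c) <= 1 / 4 * rho & dG (pt q c) v <= al * rho].
  by apply: ptP; have := ds_tri ewG u c v; lra.
exists (col c), q, q'; split=> //; first exact: colK.
by exists c; rewrite ?inE ?cN ?eqxx.
Qed.

Lemma served_belowW rho Z fp sp t u v s : (t < s)%N ->
  served w G eps al rho Z fp sp t u v -> served_below w G eps al rho Z fp sp s u v.
Proof.
elim: s => // s IH; rewrite ltnS leq_eqVlt => /orP[/eqP <-|ts] h; first by right.
by left; apply: IH.
Qed.

Lemma tree_cover_count (x0 : V) : exists (N : nat) (T : 'I_N -> graph V),
  spanning_tree_cover G w (1 + eps) T /\ N = (g * (n ^ 7 * (n ^ A.-1 * n ^ A.-1)))%N.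
Proof.
have [a a0 amin] := min_distance (@ds_gt0 _ _ _ _ ewG).
have [D DP] := diameter_exists.
have g0 : (0 < g)%N by rewrite /g -addnA addn_gt0 orbT.
have eps0 : 0 <= eps.
  by rewrite leNgt; apply/negP => h; have := eps_A; have := pow_gt0 A; nra.
have al0 : 0 < al := inv_gt0 A.
pose rho j : R := 16 * a * 2 ^+ j.
have rho0 j : 0 < rho j by rewrite !mulr_gt0.
(* [J] serves twice: the scale of level [J] exceeds the diameter, and every pair has its scale index
   below [J]. *)
have [J JP] : exists J, 2 * D <= a * 2 ^+ J.
  have [j h] := halving_lt (2 * D) a0; exists j.
  by rewrite -ler_pdivrMr ?exprn_gt0 // ltW.
have /choice[Z /choice[pt ZP]] j := scale_points (rho0 j).
(* A tree is indexed by the offset of its scales, the colour of its centres and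
   the ranks of the two preserved points among the net points near a centre. *)
pose I := ('I_g * ('I_(n ^ 7) * ('I_(n ^ A.-1) * 'I_(n ^ A.-1))))%type.
pose lev (i : I) t := (i.1 + g * t)%N.
pose sb (i : I) := served_below w G eps al (fun t => rho (lev i t))
  (fun t => Z (lev i t) i.2.1) (fun t => pt (lev i t) i.2.2.1)
  (fun t => pt (lev i t) i.2.2.2) J.
have /choice[T TP] (i : I) : exists T : graph V, [/\ subrel (adj T) (adj G), is_tree T &
    forall u v, sb i u v -> wk w T u v ((1 + eps) * dG u v)].
  apply: (spanning_tree_level ewG conG doubling (m := m) (be := be) (de := de)) => //.
  - by have := al_small; lra.
  - exact: inv_gt0.
  - exact: inv_gt0.
  - by apply: inv_le; rewrite /m -addnA leq_addr.
  - by rewrite /be divff // lt0r_neq0.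
  - exact: parameters_de.
  - exact: parameters_be.
  - move=> t; rewrite /rho /de /lev mulnS addnCA exprD.
    by have := pow_gt0 g; set y := _ ^+ g => y0; field; apply: lt0r_neq0.
  - by move=> t; have [h _] := ZP (lev i t); apply: h.
  - move=> u v; apply: le_trans (DP u v) _; rewrite /rho.
    have h : 2 ^+ J <= 2 ^+ lev i J :> R.
      rewrite ler_weXn2l ?ler1n // (leq_trans _ (leq_addl _ _)) //.
      exact: leq_pmull.
    have : a * 2 ^+ J <= a * 2 ^+ lev i J by rewrite ler_pM2l.
    have := DP x0 x0; rewrite ds_refl //; lra.
exists #|{: I}|, (fun i => T (enum_val i)); split; last first.
  by rewrite !card_prod !card_ord.
split=> [i|u v]; first by have [] := TP (enum_val i).
rewrite -(ds_gd w (conG u v)).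
suff [i h] : exists i, wk w (T i) u v ((1 + eps) * dG u v).
  exists (enum_rank i); rewrite enum_rankK; apply: gd_le h.
  by apply: edge_weight_sub ewG; have [] := TP i.
have [uv|uv] := eqVneq u v.
  have i0 : I.
    have p k : (0 < n ^ k)%N by rewrite !expn_gt0.
    exact: (Ordinal g0, (Ordinal (p 7), (Ordinal (p A.-1), Ordinal (p A.-1)))).
  by exists i0; rewrite uv ds_refl // mulr0; apply: wk_refl.
(* [j] is the scale of the pair: its offset is [j %% g] and its level in the tree is [j %/ g]. *)
have [j [j1 j2]] := scale_exists a0 (amin u v uv).
have [_ /(_ u v)[|k [q [q' [kK qQ qQ' [c cZ [h1 h2 h3 h4]]]]]]] := ZP j.
  by rewrite /rho; lra.
have jg : (j %% g < g)%N by rewrite ltn_mod.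
pose i : I := (Ordinal jg, (Ordinal kK, (Ordinal qQ, Ordinal qQ'))).
have jE : lev i (j %/ g)%N = j by rewrite /lev /= mulnC addnC -divn_eq.
exists i; have [_ _] := TP i; apply.
apply: (@served_belowW _ _ _ _ (j %/ g)%N).
  apply: leq_ltn_trans (leq_div j g) _; rewrite ltnNge; apply/negP => Jj.
  have : 2 ^+ J <= 2 ^+ j :> R by rewrite ler_weXn2l //; lra.
  by rewrite -(ler_pM2l a0); have := DP u v; lra.
exists c; rewrite /= jE //; split=> //.
(* 309 is 307 plus 2 for replacing [u] and [v] by net points. As [rho j] is less than 32 times
   [dG u v], the requirement is 309 * 32 = 9888 times [al] at most [eps]. *)
have : al * rho j <= eps / 309 * dG u v.
  have e : al * 9888 <= eps by rewrite mulrC /al ler_pdivrMr.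
  have : al * (a * 2 ^+ j) <= al * (2 * dG u v) by rewrite ler_pM2l // ltW.
  have : al * 9888 * dG u v <= eps * dG u v.
    by rewrite ler_wpM2r // ds_ge0.
  by rewrite /rho; lra.
have := ds_tri ewG u (pt j q c) (pt j q' c); have := ds_tri ewG v u (pt j q' c).
by rewrite (ds_sym ewG v (pt j q' c)) /i /=; lra.
Qed.

End FixedDimension.
End Cover.

(** * Real dimensions and the final bound *)

Lemma ltr_powR2 (R : realType) (x y : R) : x < y -> 2 `^ x < 2 `^ y.
Proof.
move=> xy; have -> : y = x + (y - x) by lra.
rewrite powRD; last by apply/implyP => _; apply/eqP; lra.
rewrite ltr_pMr ?powR_gt0 // lt_neqAle eq_sym powR_eq1.
apply/andP; split.
  by apply/norP; split; [apply/eqP; lra|apply/norP; split; [rewrite -leNgt|apply/eqP]; lra].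
by rewrite -[leLHS](powRr0 2); apply: ler_powR; lra.
Qed.

Lemma doubling_card (R : realType) (V : finType) (w : V -> V -> R) (G : graph V)
    (d : R) (n : nat) : connected_graph G -> doubling_dimension (graph_dist G w) d ->
  (forall k : nat, k%:R <= 2 `^ d :> R -> (k <= n)%N) ->
  forall x r, 0 < r -> exists C : {set V}, (#|C| <= n)%N /\
    forall y, ds w G x y <= r -> exists2 c, c \in C & ds w G c y <= r / 2.
Proof.
move=> conG dd dn x r r0; have [S [Sd Sc]] := dd x r r0; exists S; split; first exact: dn.
by move=> y; rewrite ds_gd // => /Sc[c cS cy]; exists c; rewrite ?ds_gd.
Qed.

Section SmallDimension.
Variables (R : realType) (V : finType) (w : V -> V -> R) (G : graph V) (d : R).
Hypothesis ewG : edge_weight G w.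
Hypothesis conG : connected_graph G.
Hypothesis dd : doubling_dimension (graph_dist G w) d.

Lemma dimension_ge0 : V -> 0 <= d.
Proof.
move=> x; rewrite leNgt; apply/negP => d0.
have [S [Sd Sc]] := dd x ltr01; have xx : graph_dist G w x x <= 1.
  by rewrite -ds_gd // ds_refl.
have [c cS _] := Sc x xx; have : (1 <= #|S|)%N by apply/card_gt0P; exists c.
rewrite -(ler_nat R) => /le_trans/(_ Sd); apply/negP; rewrite -ltNge.
by rewrite -[ltRHS](powRr0 2) ltr_powR2.
Qed.

(** Fewer than two centres means a single one, and [packing] with [n = 1] leaves no room for two
    points. *)
Lemma dimension_lt1 (u v : V) : d < 1 -> u = v.
Proof.
move=> d1; apply/eqP; apply: contraT => uv.
have d2 : forall k : nat, k%:R <= 2 `^ d :> R -> (k <= 1)%N.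
  move=> k kd; rewrite leqNgt -(ler_nat R) -ltNge; apply: le_lt_trans kd _.
  by rewrite -[ltRHS]powRr1 // ltr_powR2.
have uv0 : 0 < ds w G u v / 2 by rewrite divr_gt0 // ds_gt0.
have := packing ewG (doubling_card conG dd d2) (k := 1) (A := [set u; v]) (p := u) uv0.
rewrite cards2 uv exp1n => h; apply: h.
  move=> a b /set2P[]-> /set2P[]->; rewrite ?eqxx // => _; last rewrite (ds_sym ewG v u).
    by lra.
  by lra.
move=> a /set2P[]->; first by rewrite ds_refl // expr1; lra.
by rewrite expr1; lra.
Qed.

End SmallDimension.

(** The number of offsets is polynomial in [A] and [dn], so a factor 2^(3 + A + 2 dn) absorbs it,
    and the exponents add up to at most 5 [A] [dn]. *)
Lemma count_le (A dn : nat) : (0 < dn)%N -> (14 <= A)%N ->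
  ((dn * (A + 8 + 11 * dn + 9) + 7 + A) *
   ((2 ^ dn) ^ 7 * ((2 ^ dn) ^ A.-1 * (2 ^ dn) ^ A.-1)) <= (2 ^ A) ^ (5 * dn))%N.
Proof.
move=> dn0 A14; rewrite -!expnM -!expnD.
have h : (dn * (A + 8 + 11 * dn + 9) + 7 + A <= 2 ^ (3 + A + dn + dn))%N.
  rewrite !expnD; have /ltnW hA := ltn_expl A (isT : 1 < 2)%N.
  have /ltnW hd := ltn_expl dn (isT : 1 < 2)%N.
  apply: (@leq_trans (2 ^ 3 * A * dn * dn)); last by rewrite !leq_mul.
  by nia.
apply: leq_trans (leq_mul h (leqnn _)) _; rewrite -expnD leq_exp2l //.
by nia.
Qed.

(* The base is min(eps, 1/2) and not eps: as eps tends to 1, eps^(-f(d)) tends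
   to 1, whereas a long cycle always needs at least two trees. *)
Theorem theorem1p2 (R : realType) :
  exists f : R -> R, softO f id /\
  forall (V : finType) (G : graph V) (w : V -> V -> R) (d eps : R),
    edge_weight G w ->
    connected_graph G ->
    doubling_dimension (graph_dist G w) d ->
    0 < eps -> eps < 1 ->
    exists (N : nat) (T : 'I_N -> graph V),
      spanning_tree_cover G w (1 + eps) T /\
      N%:R <= Num.min eps (1 / 2) `^ (- f d).
Proof.
(* 160 = 16 * 5 * 2: 2^[A] is at most the 16th power of 1 / [e], the count is at most its power
   [5 * dn], and [dn <= 2 * d]. *)
exists (fun d => 160 * d); split.
  by exists 160, 0%N => x x0; rewrite expr0 mulr1 normrM ger0_norm.
move=> V G w d eps ewG conG dd eps0 eps1.
set e := Num.min eps (1 / 2).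
have e0 : 0 < e by rewrite /e lt_min eps0; lra.
have e2 : e <= 1 / 2 by rewrite /e ge_min lexx orbT.
have ee : e <= eps by rewrite /e ge_min lexx.
have einv : 2 <= e^-1 by rewrite -(invrK 2) lef_pV2 ?posrE ?invr_gt0 //; lra.
have [x0 _|V0] := pickP V; last first.
  exists 0%N, (fun i => G); split; last exact: powR_ge0.
  by split=> [[]|u] //; have := V0 u.
have d0 := dimension_ge0 ewG conG dd x0.
have einvR x : e `^ (- x) = e^-1 `^ x.
  by rewrite -powR_inv1 ?ltW // -powRrM mulN1r.
(* Dimensions below 1 are set apart because [dn <= 2 * d] needs [1 <= d]; such a graph has one
   vertex and is its own cover. *)
rewrite einvR; have [d1|d1] := ltP d 1.
  have V1 := dimension_lt1 ewG conG dd _ _ d1.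
  exists 1%N, (fun=> G); split.
    split=> [_|u v]; last first.
      by exists ord0; rewrite ler_peMl ?gd_ge0 //; lra.
    split=> //; split=> // c /andP[_]; case: c => [|x [|y c]] //=.
    by rewrite (V1 x y) inE eqxx.
  rewrite -[leLHS](powRr0 e^-1); apply: ler_powR; lra.
have /andP[t1 t2] := truncn_itv d0; set dn := (Num.truncn d).+1 in t2.
have dn2 : dn%:R <= 2 * d by rewrite /dn -natr1; lra.
have db := @doubling_card _ _ _ _ _ (2 ^ dn)%N conG dd.
(* 2^14 is a power of two above 9888, and it also gives [14 <= A]. *)
have [|A [A1 A2]] := @scale_exists R 1 (2 ^+ 14 / e) ltr01.
  by rewrite ler_pdivlMr // mul1r; have := @exprn_ege1 R 2 14; lra.
rewrite mul1r in A1 A2.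
have A14 : (14 <= A)%N.
  rewrite -(@ler_eXn2l R 2) ?ltr1n //; apply: le_trans A1.
  by rewrite ler_peMr ?exprn_ge0 //; lra.
have epsA : 9888 <= eps * 2 ^+ A.
  have : 2 ^+ 14 <= eps * 2 ^+ A.
    apply: le_trans (_ : e * 2 ^+ A <= _); last by rewrite ler_pM2r // exprn_gt0.
    by rewrite mulrC -ler_pdivrMr.
  by apply: le_trans; rewrite (_ : 2 ^+ 14 = 16384); [lra|ring].
have [|N [T [cov NE]]] := tree_cover_count ewG conG (dn := dn) A14 _ epsA x0.
  apply: db => k; move=> kd; rewrite -(ler_nat R) natrX; apply: le_trans kd _.
  by rewrite -powR_mulrn //; apply: ler_powR; lra.
exists N, T; split=> //.
(* 2^[A] is less than 2^15 / [e], and 2 is at most 1 / [e]. *)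
have A16 : 2 ^+ A <= e^-1 ^+ 16.
  apply: ltW (lt_le_trans A2 _); rewrite mulrA -exprS [leRHS]exprSr ler_pM2r ?invr_gt0 //.
  by rewrite lerXn2r // nnegrE //; lra.
have : N%:R <= (e^-1 ^+ 16) ^+ (5 * dn).
  apply: le_trans (_ : (2 ^+ A) ^+ (5 * dn) <= _).
    by rewrite -!natrX ler_nat NE count_le.
  by rewrite lerXn2r // nnegrE exprn_ge0 //; lra.
move/le_trans; apply; rewrite -exprM -powR_mulrn; last by lra.
by apply: ler_powR; [lra|rewrite mulnA natrM; lra].
Qed.
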